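(* Assume that $\ln \ln L\geq 1$. Given levels $\alpha$ and $\beta$ in $]0,1[$, let $\Phi_\alpha^{(1)}$ be the first test (defined in the context) with $\mathcal{J}=\{1,\ldots,\lfloor\log_2(L^2/(\ln\ln L)^3)\rfloor\}$ and $W_J=\ln|\mathcal{J}|$ for every $J\in\mathcal{J}$. Let $R,R''>0$. For every $\delta>0$, there exists some positive constant $C(\alpha,\beta,R'',\delta)$ such that when $s$ belongs to $\mathcal{B}_{2,\infty}^\delta(R)\cap \mathbb{L}^\infty(R'')$ and satisfies $$d^2(s,\mathcal{S}_0)> C(\alpha,\beta,R'',\delta)\left(R^{\frac{2}{4\delta +1}} \left( \frac{\sqrt{\ln\ln L}}{L}\right)^{\frac{4\delta}{4\delta +1}}+R^2\left(\frac{(\ln \ln L)^3}{L^2}\right)^{2\delta}+\frac{\ln\ln L}{L}\right),$$ then $\mathbb{P}_s(\Phi_{\alpha}^{(1)}=0)\leq \beta$. In particular, there exist some positive constants $L_0(\delta)$ and $C(\alpha,\beta,R,R'',\delta)$ such that if $L>L_0(\delta)$, then $$\rho(\Phi_\alpha^{(1)},\mathcal{B}_{2,\infty}^\delta(R)\cap \mathbb{L}^\infty(R''),\beta)\leq C(\alpha,\beta,R,R'',\delta)\left( \frac{\sqrt{\ln\ln L}}{L}\right)^{\frac{2\delta}{4\delta +1}}.$$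
   Context: A constant written $C(a,b,\dots)$ or $L_0(a,\dots)$ depends only on the listed parameters (in particular not on $L$ or $s$). Setting. One observes a Poisson process $N$ on $[0,1]$ with intensity $s\ge0$, $s\in\mathbb{L}^2([0,1])$, with respect to $d\mu(x)=L\,dx$ (mean measure $L s(x)dx$); $\mathbb{P}_s$ is its distribution, $X_1,\dots,X_{N_L}$ its points, $N_L$ their number. $\|\cdot\|,\langle\cdot,\cdot\rangle,d$ are the norm, scalar product and distance of $\mathbb{L}^2([0,1],dx)$; $\mathcal{S}_0$ is the set of constant functions on $[0,1]$. Haar basis: $\phi_0=\mathbf{1}_{[0,1]}$, $\phi_{(j,k)}(x)=2^{j/2}\psi(2^jx-k)$, $j\in\mathbb{N}$, $0\le k\le 2^j-1$, $\psi=\mathbf{1}_{[0,1/2[}-\mathbf{1}_{[1/2,1[}$. For $J\ge1$, $\Lambda_J=\{(j,k): 0\le j\le J-1,\ 0\le k\le 2^j-1\}$. Classes: $\mathcal{B}_{2,\infty}^\delta(R)=\{s\ge0,\ s\in\mathbb{L}^2([0,1]):\forall j\in\mathbb{N},\ \sum_{k=0}^{2^j-1}\langle s,\phi_{(j,k)}\rangle^2\le R^22^{-2j\delta}\}$; $\mathbb{L}^\infty(R'')$ is the set of functions bounded by $R''$. Uniform separation rate: $\rho(\Phi,\mathcal{S}_1,\beta)=\inf\{\rho>0:\ \sup_{s\in\mathcal{S}_1,\,d(s,\mathcal{S}_0)>\rho}\mathbb{P}_s(\Phi=0)\le\beta\}$. First test. For $\lambda=(j,k)$ let $T_\lambda=\frac1{L^2}\sum_{l\ne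 l'=1}^{N_L}\phi_\lambda(X_l)\phi_\lambda(X_{l'})$ and $T'_J=\sum_{\lambda\in\Lambda_J}T_\lambda$. Under the null hypothesis $s\in\mathcal{S}_0$, conditionally on $N_L=n$, the points are $n$ i.i.d. uniform variables on $[0,1]$, so the conditional law of $(T'_J)_J$ does not depend on $s\in\mathcal{S}_0$. For $u\in]0,1[$, $q_J'^{(n)}(u)$ is the $(1-u)$ quantile of $T'_J$ given $N_L=n$ under the null hypothesis. Given a finite set $\mathcal{J}\subset\mathbb{N}\setminus\{0\}$ and positive weights $(W_J)_{J\in\mathcal{J}}$ with $\sum_{J\in\mathcal{J}}e^{-W_J}\le1$, set $$u_{J,\alpha}'^{(n)}=e^{-W_J}\sup\Big\{u\in]0,1[:\ \sup_{s\in\mathcal{S}_0}\mathbb{P}_s\Big(\sup_{J\in\mathcal{J}}\big(T'_J-q_J'^{(n)}(ue^{-W_J})\big)>0\,\Big|\,N_L=n\Big)\le\alpha\Big\},$$ $\mathcal{T}_\alpha^{(1)}=\sup_{J\in\mathcal{J}}\big(T'_J-q_J'^{(N_L)}(u_{J,\alpha}'^{(N_L)})\big)$ and $\Phi_\alpha^{(1)}=\mathbf{1}_{\mathcal{T}_\alpha^{(1)}>0}$. *)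

(* Defs.v *)
(* MathComp / MathComp-Analysis. *)
From HB Require Import structures.
From mathcomp Require Import all_boot all_order all_algebra.
From mathcomp Require Import all_classical all_reals all_analysis.
Set Implicit Arguments.
Unset Strict Implicit.
Unset Printing Implicit Defensive.
Import Order.TTheory GRing.Theory Num.Theory.
Import numFieldNormedType.Exports.
Local Open Scope classical_set_scope.
Local Open Scope ring_scope.

Section L2_unit_interval.
Context {R : realType}.
Implicit Types (f g s : R -> R) (S : set (R -> R)).

(* Functions on [0, 1] are represented by functions on R; every notion below
   depends only on their restriction to [0, 1]. *)

Definition square_integrable f : Prop :=
  measurable_fun (`[0, 1] : set R) f /\
  (@lebesgue_measure R).-integrable `[0, 1] (fun x => (f x ^+ 2)%:E).

Definition inner f g : R := \int[@lebesgue_measure R]_(x in `[0, 1]) (f x * g x).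

Definition l2norm f : R := Num.sqrt (inner f f).

Definition l2dist s S : R := inf [set l2norm (fun x => s x - f x) | f in S].

Definition constant_functions : set (R -> R) :=
  [set f | exists c : R, forall x, 0 <= x <= 1 -> f x = c].

Definition intensities : set (R -> R) :=
  [set s | square_integrable s /\ forall x, 0 <= x <= 1 -> 0 <= s x].

Definition psi (x : R) : R := \1_(`[0, 2^-1[) x - \1_(`[2^-1, 1[) x.

Definition haar (j k : nat) (x : R) : R :=
  2 `^ (j%:R / 2) * psi (2 ^+ j * x - k%:R).

Definition besov_ball (delta r : R) : set (R -> R) :=
  [set s | intensities s /\
    forall j : nat, \sum_(k < 2 ^ j) inner s (haar j k) ^+ 2
                    <= r ^+ 2 * 2 `^ (- (2 * j%:R * delta))].

Definition sup_ball (M : R) : set (R -> R) :=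
  [set s | forall x, 0 <= x <= 1 -> `|s x| <= M].

End L2_unit_interval.

Section poisson_experiment.
Context {R : realType} {d : measure_display} {Omega : measurableType d}.
(* [N w] is the number of points and [X 0 w, ..., X (N w).-1 w] are the points;
   the values [X l w] with [N w <= l] are irrelevant. *)
Variables (N : Omega -> nat) (X : nat -> Omega -> R).

Definition count_in (A : set R) (w : Omega) : nat :=
  (\sum_(l < N w) (X l w \in A))%N.

(* Poisson process with mean measure L s(x) dx on [0, 1]. The nat argument of
   the library's [poisson_prob] is unused (it is set to 0 below). *)
Definition is_poisson_process (P : probability Omega R) (L : R) (s : R -> R) :
    Prop :=
  (forall A : set R, measurable A -> forall B : set nat,
     P (count_in A @^-1` B) =
     poisson_prob (L * \int[@lebesgue_measure R]_(x in A `&` `[0, 1]) s x) 0 B)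
  /\
  (forall (m : nat) (A : 'I_m -> set R), (forall i, measurable (A i)) ->
     trivIset setT A ->
     forall B : 'I_m -> set nat,
     P (\bigcap_i (count_in (A i) @^-1` B i)) =
     (\prod_(i < m) P (count_in (A i) @^-1` B i))%E).

(* The statistical experiment: one observation (N, X), and the family of its
   possible distributions, [P s] being the one under the intensity s with
   respect to L dx. *)
Definition poisson_experiment (L : R) (P : (R -> R) -> probability Omega R) :
    Prop :=
  [/\ measurable_fun setT N,
      forall l, measurable_fun setT (X l),
      forall w l, (l < N w)%N -> 0 <= X l w <= 1 &
      forall s, intensities s -> is_poisson_process (P s) L s].

Definition stat_coef (L : R) (j k : nat) (w : Omega) : R :=
  (L ^+ 2)^-1 *
  \sum_(l < N w) \sum_(l' < N w | l' != l)
     haar j k (X l w) * haar j k (X l' w).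

Definition stat (L : R) (J : nat) (w : Omega) : R :=
  \sum_(j < J) \sum_(k < 2 ^ j) stat_coef L j k w.

Variables (L : R) (P : (R -> R) -> probability Omega R).

Definition cond_prob (s : R -> R) (n : nat) (E : set Omega) : R :=
  fine (P s (E `&` [set w | N w = n])) / fine (P s [set w | N w = n]).

(* The (1 - u) quantile of T'_J given N = n under the null hypothesis. All the
   null intensities under which {N = n} is not negligible give the same
   conditional law; the constant intensity 1, for which this holds for every n,
   is taken as representative. *)
Definition null_quantile (J n : nat) (u : R) : R :=
  inf [set t | 1 - u <= cond_prob (cst 1) n [set w | stat L J w <= t]].

(* sup_(J in Js) (T'_J - threshold J), equal to -oo when Js is empty *)
Definition sup_stat (Js : seq nat) (threshold : nat -> R) (w : Omega) : \bar R :=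
  \big[Order.max/-oo%E]_(J <- Js) (stat L J w - threshold J)%:E.

(* sup over s in S_0 of P_s (sup_J (T'_J - q_J^(n) (u e^(-W_J))) > 0 | N = n),
   restricted to the s for which the conditioning event is not negligible
   (this only discards s = 0 when n > 0). *)
Definition null_rejection_prob (Js : seq nat) (W : nat -> R) (n : nat) (u : R) :
    R :=
  sup [set cond_prob s n
         [set w | (0 < sup_stat Js
                         (fun J => null_quantile J n (u * expR (- W J))) w)%E]
      | s in [set s | constant_functions s /\ intensities s /\
                      P s [set w | N w = n] != 0%E]].

Definition level_coef (Js : seq nat) (W : nat -> R) (alpha : R) (J n : nat) : R :=
  expR (- W J) *
  sup [set u | 0 < u < 1 /\ null_rejection_prob Js W n u <= alpha].

Definition test_stat (Js : seq nat) (W : nat -> R) (alpha : R) (w : Omega) :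
    \bar R :=
  sup_stat Js
    (fun J => null_quantile J (N w) (level_coef Js W alpha J (N w))) w.

Definition test (Js : seq nat) (W : nat -> R) (alpha : R) (w : Omega) : nat :=
  if (0 < test_stat Js W alpha w)%E then 1 else 0.

Definition separation_rate (Phi : Omega -> nat) (S : set (R -> R)) (beta : R) :
    \bar R :=
  ereal_inf [set r%:E | r in [set r : R | 0 < r /\
    (ereal_sup [set P s [set w | Phi w = 0%N]
               | s in [set s | S s /\ (r < l2dist s constant_functions)%R]]
     <= beta%:E)%E]].

(* J = {1, ..., floor (log_2 (L^2 / (ln ln L)^3))} and W_J = ln |J| *)
Definition levels : seq nat :=
  iota 1 (Num.truncn (ln (L ^+ 2 / ln (ln L) ^+ 3) / ln 2)).

Definition test1 (alpha : R) : Omega -> nat :=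
  test levels (fun=> ln (size levels)%:R) alpha.

End poisson_experiment.

(* Main.v *)
Require Import Defs.
From HB Require Import structures.
From mathcomp Require Import all_boot all_order all_algebra.
From mathcomp Require Import all_classical all_reals all_analysis.
From mathcomp Require Import measurable_realfun.
From mathcomp Require Import ring lra.
Set Implicit Arguments.
Unset Strict Implicit.
Unset Printing Implicit Defensive.
Import Order.TTheory GRing.Theory Num.Theory.
Import numFieldNormedType.Exports.
Local Open Scope classical_set_scope.
Local Open Scope ring_scope.

(** The Haar kernel of resolution [J] only depends on the dyadic cells, so that
[L^2 T'_J = D sum_c N_c (N_c - 1) - N (N - 1)], where [D = 2^J], [N_c] counts the points in the
[c]-th cell of length [1 / D], and the point 1, where all the Haar functions vanish, is almost
surely not observed.

Given [N = n] and under the null hypothesis, [n] balls are thrown uniformly in [D] cells. Each ball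
adds a centered increment to [L^2 T'_J], whose conditional variance is an affine function of the
current value; an exponential supermartingale, truncated by a bound on the fullest cell, gives the
tail bound [exp (- 2 t)] at a level of order [n (sqrt (D t) + t)], for [D t^3 <= L^2]. With
[t = ln ln L] this controls the quantiles of level [alpha / |J|], since [|J|] is of order [exp t].

Under [P_s] the counts are independent Poisson variables, and [L^2 T'_J] minus its mean is the
difference of two sums of Charlier polynomials of degree at most 2, to which Chebyshev's inequality
applies. Its mean is [L^2] times the sum of the squared Haar coefficients of [s] up to level [J],
which by completeness of the Haar basis differs from [d^2(s, S_0)] by at most [r^2 D^(-2 delta)] up
to a constant. It remains to choose [D] such that bias and deviation balance. *)

(** * Throwing balls uniformly into cells *)

(** The test compares up to order [ln L] statistics with quantiles of level at least [alpha / |J|].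
    Chebyshev's inequality at that level would put a power of [ln L] where [ln ln L] is claimed,
    hence the exponential bound under the null. Two features of [collisions] stand in its way. A
    ball falling in cell [c] moves it by [2 (D v_c - total)], which is not bounded, hence the cap on
    the fullest cell. The conditional variance of this move grows with [collisions] itself, hence
    the argument stops at the first passage above the level.

    The quantiles are conditional on [N = n], while the tail bound needs [n <= K L]; under the
    alternative, [N] exceeds [K L] with probability at most [beta / 2]. Under the alternative second
    moments suffice, because only one level [J] has to reject.

    The constant may depend neither on [L] nor on [r]. The tail bound only starts at some [L1]
    depending on [alpha], [beta] and the sup bound; below it the separation hypothesis is void,
    since the distance is bounded while [ln ln L / L] is bounded below. *)

Section occupancy.
Context {R : realType} {T : finType}.
Implicit Types (v w : {ffun T -> nat}) (c : T) (F G : {ffun T -> nat} -> R).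

Definition addball v c : {ffun T -> nat} := [ffun x => (v x + (x == c))%N].

(* Expectation of [F] at the occupancy vector obtained from [v] by throwing [n]
   further balls independently and uniformly into the cells. *)
Fixpoint throw (n : nat) F v : R :=
  if n is n'.+1 then #|T|%:R^-1 * \sum_c throw n' F (addball v c) else F v.

Definition total v : nat := (\sum_c v c)%N.

Definition collisions v : R :=
  #|T|%:R * \sum_c ((v c)%:R ^+ 2 - (v c)%:R) - ((total v)%:R ^+ 2 - (total v)%:R).

Lemma total_addball v c : total (addball v c) = (total v).+1.
Proof.
rewrite /total; under eq_bigr do rewrite ffunE.
rewrite big_split /= addnC -addn1 addnC; congr addn.
by rewrite (bigD1 c) //= eqxx big1 ?addn0 // => i /negbTE ->.
Qed.

Lemma throwD n F G v : throw n (fun w => F w + G w) v = throw n F v + throw n G v.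
Proof.
elim: n v => //= n IH v; rewrite -mulrDr -big_split /=; congr (_ * _).
by apply: eq_bigr => c _; exact: IH.
Qed.

Lemma throwZ n (a : R) F v : throw n (fun w => a * F w) v = a * throw n F v.
Proof.
elim: n v => //= n IH v; rewrite mulrCA; congr (_ * _); rewrite mulr_sumr.
by apply: eq_bigr => c _; exact: IH.
Qed.

Lemma throw_sum n (I : Type) (r : seq I) (F : I -> {ffun T -> nat} -> R) v :
  throw n (fun w => \sum_(i <- r) F i w) v = \sum_(i <- r) throw n (F i) v.
Proof.
elim: r => [|i r IH]; last first.
  rewrite big_cons -IH -throwD; congr (throw n _ v); apply/funext => w.
  by rewrite big_cons.
rewrite big_nil -[RHS](mul0r (throw n (fun=> 0) v)) -throwZ.
by congr (throw n _ v); apply/funext => w; rewrite big_nil mul0r.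
Qed.

(** Only the vectors reachable from [v] matter: their total is prescribed and no count decreases.
    This is what makes a cell that is already too full rule out an event. *)
Lemma eq_throw_ge n F G v :
  (forall w, total w = (total v + n)%N -> (forall c, (v c <= w c)%N) -> F w = G w) ->
  throw n F v = throw n G v.
Proof.
elim: n v => [|n IH] v FG /=; first by apply: FG => //; rewrite addn0.
congr (_ * _); apply: eq_bigr => c _; apply: IH => w; rewrite total_addball => tw vw.
apply: FG; first by rewrite tw addSnnS.
by move=> x; apply: leq_trans (vw x); rewrite ffunE leq_addr.
Qed.

Lemma throw_le n F G v : (forall w, F w <= G w) -> throw n F v <= throw n G v.
Proof.
move=> FG; elim: n v => //= n IH v; apply: ler_wpM2l; first by rewrite invr_ge0.
by apply: ler_sum => c _; exact: IH.
Qed.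

Hypothesis T_gt0 : (0 < #|T|)%N.

Let D : R := #|T|%:R.

Let D_gt0 : 0 < D. Proof. by rewrite ltr0n. Qed.

Lemma throw_cst n (a : R) v : throw n (fun=> a) v = a.
Proof.
elim: n v => //= n IH v; under eq_bigr do rewrite IH.
by rewrite sumr_const -[a *+ _]mulr_natl mulrA mulVf ?mul1r // gt_eqF.
Qed.

Lemma throw_le1 n (p : {ffun T -> nat} -> bool) v : throw n (fun w => (p w)%:R) v <= 1.
Proof. by rewrite -[leRHS](throw_cst n 1 v); apply: throw_le => w; rewrite lern1 leq_b1. Qed.

(** Peels off the last ball instead of the first, as the induction for the multinomial law
    requires. *)
Lemma throwSr n F v :
  throw n.+1 F v = throw n (fun w => D^-1 * \sum_c F (addball w c)) v.
Proof.
elim: n v => //= n IH v; congr (_ * _); apply: eq_bigr => c _; exact: IH.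
Qed.

Lemma collisions_addball v c :
  collisions (addball v c) = collisions v + 2 * (D * (v c)%:R - (total v)%:R).
Proof.
rewrite /collisions total_addball -/D -natr1.
have -> : \sum_x ((addball v c x)%:R ^+ 2 - (addball v c x)%:R) =
  \sum_x ((v x)%:R ^+ 2 - (v x)%:R) + 2 * (v c)%:R :> R.
  rewrite (bigD1 c) //= [in RHS](bigD1 c) //= ffunE eqxx addn1 -natr1.
  have -> : \sum_(i | i != c) ((addball v c i)%:R ^+ 2 - (addball v c i)%:R) =
     \sum_(i | i != c) ((v i)%:R ^+ 2 - (v i)%:R) :> R.
    by apply: eq_bigr => i /negbTE ic; rewrite ffunE ic addn0.
  by ring.
by ring.
Qed.

Lemma natr_total v : (total v)%:R = \sum_c (v c)%:R :> R.
Proof. by rewrite /total natr_sum. Qed.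

(** Reduces to [(1 - y) (1 + y + 2 y^2) = 1 + y^2 (1 - 2 y) >= 1]. No lower bound on [y] is imposed,
    so the increments only have to be capped from above. *)
Lemma expR_le_quad (y : R) : y <= 2^-1 -> expR y <= 1 + y + 2 * y ^+ 2.
Proof.
move=> y2; have y1 : 0 < 1 - y by lra.
have /ler_pM2l <- : 0 < expR (- y) by rewrite expR_gt0.
rewrite -expRD addNr expR0.
apply: (@le_trans _ _ ((1 - y) * (1 + y + 2 * y ^+ 2))); first by nra.
by apply: ler_wpM2r; [nra|exact: expR_ge1Dx].
Qed.

(* Throwing one ball changes [collisions] by [2 (D v_c - total v)], which is centered and whose
   second moment is controlled by [collisions v] itself: as long as [collisions] does not exceed
   [x], the process [exp (lam * collisions)] grows by a factor at most [exp (lam ^ 2 V)]. *)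
Lemma throw_collisions_exp (n0 m x lam : R) k v :
  0 <= x -> 0 <= lam -> 4 * lam * (D * m) <= 1 ->
  (total v + k)%:R <= n0 ->
  throw k (fun w => ((x < collisions w) && [forall c, (w c)%:R <= m])%:R) v
  <= expR (lam * (collisions v - x) + lam ^+ 2 * (8 * (x + D * n0)) * k%:R).
Proof.
move=> x0 lam0 lamDm; set V := 8 * (x + D * n0).
have D0 := D_gt0.
elim: k v => [|k IH] v vn /=.
  rewrite mulr0 addr0; case: ltP => xU /=; last exact: expR_ge0.
  apply: (@le_trans _ _ 1); first by rewrite lern1 leq_b1.
  by rewrite -expR0 ler_expR mulr_ge0 // subr_ge0 ltW.
have n00 : 0 <= n0 by apply: le_trans vn.
have V0 : 0 <= V by rewrite /V mulr_ge0 // addr_ge0 // mulr_ge0 // ltW.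
(* Above the level [x] the claimed bound is at least 1. Below it, [collisions v <= x] controls the
   variance of the next increment. *)
have [xU|Ux] := ltP x (collisions v).
  apply: le_trans (_ : 1 <= _); last first.
    rewrite -expR0 ler_expR; apply: addr_ge0; first by rewrite mulr_ge0 // subr_ge0 ltW.
    by apply: mulr_ge0 => //; apply: mulr_ge0 => //; exact: sqr_ge0.
  exact: (@throw_le1 k.+1).
(* A cell with more than [m] balls keeps them, and the event has become impossible. *)
have [/forallP vm|/forallPn[c0 vm]] := boolP [forall c, (v c)%:R <= m]; last first.
  rewrite -[X in X <= _]/(throw k.+1 _ v).
  rewrite (@eq_throw_ge _ _ (fun=> 0)); first by rewrite throw_cst expR_ge0.
  move=> w _ vw; case: forallP => [wm|_]; last by rewrite andbF.
  by move: vm; rewrite (le_trans _ (wm c0)) // ler_nat.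
pose y c : R := 2 * lam * (D * (v c)%:R - (total v)%:R).
have y2 c : y c <= 2^-1.
  rewrite /y; have : 4 * lam * (D * (v c)%:R) <= 1.
    by apply: le_trans lamDm; do 2 (apply: ler_wpM2l; rewrite ?mulr_ge0 // ?(ltW D0)).
  have : 0 <= lam * (total v)%:R by rewrite mulr_ge0.
  by lra.
set B := expR (lam * (collisions v - x) + lam ^+ 2 * V * k%:R).
have step c : throw k (fun w => ((x < collisions w) && [forall c, (w c)%:R <= m])%:R)
    (addball v c) <= B * (1 + y c + 2 * y c ^+ 2).
  apply: le_trans (IH (addball v c) _) _; first by rewrite total_addball addSnnS.
  rewrite collisions_addball.
  have -> : lam * (collisions v + 2 * (D * (v c)%:R - (total v)%:R) - x) +
     lam ^+ 2 * V * k%:R = lam * (collisions v - x) + lam ^+ 2 * V * k%:R + y c.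
    by rewrite /y; ring.
  rewrite expRD; apply: ler_wpM2l; first exact: expR_ge0.
  exact: expR_le_quad.
apply: (@le_trans _ _ (D^-1 * \sum_c B * (1 + y c + 2 * y c ^+ 2))).
  by apply: ler_wpM2l; [rewrite invr_ge0 ltW|apply: ler_sum => c _; exact: step].
rewrite -mulr_sumr mulrCA.
have -> : lam * (collisions v - x) + lam ^+ 2 * V * k.+1%:R =
  lam * (collisions v - x) + lam ^+ 2 * V * k%:R + lam ^+ 2 * V.
  by rewrite -natr1; ring.
rewrite [leRHS]expRD -/B; apply: ler_wpM2l; first exact: expR_ge0.
apply: le_trans (expR_ge1Dx _); rewrite mulrC ler_pdivrMr //.
have sy : \sum_c y c = 0.
  rewrite /y -mulr_sumr sumrB -mulr_sumr sumr_const natr_total -[X in _ - X]mulr_natl.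
  by rewrite subrr mulr0.
have sy2 : \sum_c y c ^+ 2 =
   4 * lam ^+ 2 * D * (D * (\sum_c (v c)%:R ^+ 2) - (total v)%:R ^+ 2).
  rewrite /y; under eq_bigr do rewrite exprMn.
  rewrite -mulr_sumr.
  have -> : \sum_i (D * (v i)%:R - (total v)%:R) ^+ 2 =
     \sum_i (D ^+ 2 * (v i)%:R ^+ 2 - 2 * D * (total v)%:R * (v i)%:R + (total v)%:R ^+ 2).
    by apply: eq_bigr => i _; ring.
  rewrite big_split /= sumrB -!mulr_sumr sumr_const -natr_total -[_ *+ #|_|]mulr_natl -/D.
  by ring.
rewrite big_split /= big_split /= sumr_const sy -mulr_sumr sy2.
have -> : D * \sum_c (v c)%:R ^+ 2 - (total v)%:R ^+ 2 =
  collisions v + D * (total v)%:R - (total v)%:R.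
  by rewrite /collisions -/D sumrB -natr_total; ring.
have tn : (total v)%:R <= n0.
  by apply: le_trans vn; rewrite ler_nat leq_addr.
have cV : collisions v + D * (total v)%:R - (total v)%:R <= x + D * n0.
  have : D * (total v)%:R <= D * n0 by rewrite ler_pM2l.
  have : 0 <= (total v)%:R :> R by [].
  by lra.
have -> : 1 *+ #|xpredT : pred T| = D by [].
rewrite addr0 [leRHS]mulrDl mul1r lerD2l /V.
have -> : 2 * (4 * lam ^+ 2 * D * (collisions v + D * (total v)%:R - (total v)%:R)) =
  8 * lam ^+ 2 * D * (collisions v + D * (total v)%:R - (total v)%:R) by ring.
have -> : lam ^+ 2 * (8 * (x + D * n0)) * D = 8 * lam ^+ 2 * D * (x + D * n0) by ring.
by apply: ler_wpM2l; rewrite // !mulr_ge0 ?sqr_ge0 // ltW.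
Qed.

(** A ball falls in cell [c] with probability [1 / D] and then multiplies [z ^ v_c] by [z], so each
    throw multiplies the expected sum by [1 + (z - 1) / D]. *)
Lemma throw_sum_exp n (z : R) v :
  throw n (fun w => \sum_c z ^+ w c) v = (\sum_c z ^+ v c) * (1 + (z - 1) / D) ^+ n.
Proof.
elim: n v => [|n IH] v; first by rewrite expr0 mulr1.
rewrite /=; under eq_bigr do rewrite IH.
rewrite -mulr_suml exprS !mulrA; congr (_ * _).
have E c : \sum_x z ^+ (addball v c x) = (\sum_x z ^+ v x) + (z - 1) * z ^+ v c.
  rewrite (bigD1 c) //= [in RHS](bigD1 c) //= ffunE eqxx addn1 exprS.
  under eq_bigr => i /negbTE ic do rewrite ffunE ic addn0.
  by ring.
rewrite (eq_bigr _ (fun c _ => E c)).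
rewrite big_split /= sumr_const -mulr_natl -mulr_sumr -/D.
by field; rewrite gt_eqF.
Qed.

(** Chernoff's bound for the fullest cell: the indicator is at most [z ^- m] times the sum of the
    [z ^ w_c]. *)
Lemma throw_exists_gt n (z : R) (m : nat) : 1 <= z ->
  throw n (fun w => [exists c, (m < w c)%N]%:R) [ffun=> 0%N]
  <= D * z ^- m * expR ((z - 1) * n%:R / D).
Proof.
move=> z1; have z0 : 0 < z by lra.
have zm : 0 <= z ^- m by rewrite invr_ge0 exprn_ge0 // ltW.
apply: (@le_trans _ _ (throw n (fun w => z ^- m * \sum_c z ^+ w c) [ffun=> 0%N])).
  apply: throw_le => w; case: existsP => [[c mc]|_]; last first.
    by rewrite mulr_ge0 // sumr_ge0 // => c _; rewrite exprn_ge0 // ltW.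
  rewrite (bigD1 c) //= mulrDr -[leLHS]addr0; apply: lerD.
    rewrite mulrC ler_pdivlMr ?exprn_gt0 // mul1r.
    by apply: ler_weXn2l => //; exact: ltnW.
  by rewrite mulr_ge0 // sumr_ge0 // => i _; rewrite exprn_ge0 // ltW.
have sD : \sum_(c : T) z ^+ ([ffun=> 0%N] : {ffun T -> nat}) c = D.
  under eq_bigr do rewrite ffunE expr0.
  by rewrite sumr_const.
rewrite throwZ throw_sum_exp sD mulrA [z ^- m * D]mulrC.
apply: ler_wpM2l; first by rewrite mulr_ge0 // ltW.
have -> : (z - 1) * n%:R / D = n%:R * ((z - 1) / D) by ring.
rewrite expRM_natl; apply: lerXn2r; rewrite ?nnegrE ?expR_ge0 //.
  by rewrite addr_ge0 // divr_ge0 ?subr_ge0 // ltW.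
exact: expR_ge1Dx.
Qed.

(** Either every cell has at most [m] balls or the Chernoff bound applies. The cap [m] and the
    parameter [z] stay free, since coarse and fine partitions call for different choices. *)
Lemma throw_collisions_gt n (n0 x lam z : R) (m : nat) :
  0 <= x -> 0 <= lam -> 4 * lam * (D * m%:R) <= 1 -> n%:R <= n0 -> 1 <= z ->
  throw n (fun w => (x < collisions w)%R%:R) [ffun=> 0%N]
  <= expR (- (lam * x) + lam ^+ 2 * (8 * (x + D * n0)) * n0) +
     D * z ^- m * expR ((z - 1) * n0 / D).
Proof.
move=> x0 lam0 lamDm nn0 z1.
have n00 : 0 <= n0 by apply: le_trans nn0.
apply: le_trans (_ : throw n (fun w => ((x < collisions w) && [forall c, (w c)%:R <= m%:R :> R])%:R
   + [exists c, (m < w c)%N]%:R) [ffun=> 0%N] <= _).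
  apply: throw_le => w; case: ltP => _ //=; last by rewrite addr_ge0.
  rewrite -natrD ler_nat; case: (boolP [forall c, _]) => //= /forallPn[c wc].
  by case: existsP => // -[]; exists c; rewrite ltnNge -(ler_nat R).
rewrite throwD; apply: lerD; last first.
  apply: le_trans (throw_exists_gt n m z1) _.
  apply: ler_wpM2l.
    apply: mulr_ge0; first exact: ltW.
    by rewrite invr_ge0 exprn_ge0 // (le_trans ler01).
  rewrite ler_expR ler_pM2r ?invr_gt0 //; by apply: ler_wpM2l => //; rewrite subr_ge0.
have tot0 : total [ffun=> 0%N] = 0%N by rewrite /total big1 // => c _; rewrite ffunE.
apply: le_trans (@throw_collisions_exp n0 m%:R x lam n [ffun=> 0%N] x0 lam0 lamDm _) _.
  by rewrite tot0.
rewrite ler_expR; apply: lerD.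
  rewrite /collisions tot0 big1; first by rewrite le_eqVlt; apply/orP; left; apply/eqP; ring.
  by move=> c _; rewrite ffunE expr0n subrr.
apply: ler_wpM2l => //; rewrite mulr_ge0 ?sqr_ge0 // mulr_ge0 // addr_ge0 // mulr_ge0 //.
Qed.

End occupancy.

(** * Dyadic cells and the Haar kernel *)

Lemma big_ord_double {V : Type} {idx : V} (op : Monoid.law idx) n (F : nat -> V) :
  \big[op/idx]_(c < n.*2) F c = \big[op/idx]_(k < n) op (F k.*2) (F k.*2.+1).
Proof.
elim: n => [|n IH]; first by rewrite !big_ord0.
by rewrite doubleS !big_ord_recr /= IH Monoid.mulmA.
Qed.

(** The identity [(a0 - a1) (b0 - b1) = 2 (a0 b0 + a1 b1) - (a0 + a1) (b0 + b1)] makes the sum over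
    the levels telescope. It is applied to indicators of cells, for the Haar kernel, and to masses
    of cells, for the energy of [s]. *)
Lemma sum_refinement {K : comPzRingType} (a b : nat -> nat -> K) :
  (forall j k, a j k = a j.+1 k.*2 + a j.+1 k.*2.+1) ->
  (forall j k, b j k = b j.+1 k.*2 + b j.+1 k.*2.+1) ->
  forall J,
  \sum_(j < J) \sum_(k < 2 ^ j) 2 ^+ j *
     ((a j.+1 k.*2 - a j.+1 k.*2.+1) * (b j.+1 k.*2 - b j.+1 k.*2.+1)) =
  2 ^+ J * (\sum_(c < 2 ^ J) a J c * b J c) - a 0 0 * b 0 0.
Proof.
move=> aE bE; elim=> [|J IH].
  by rewrite big_ord0 expn0 big_ord_recl big_ord0 expr0 mul1r addr0 subrr.
rewrite big_ord_recr IH /= [X in X + _]addrC -addrA addrC; congr (_ + _).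
rewrite expnS mul2n (big_ord_double _ _ (fun c => a J.+1 c * b J.+1 c)).
rewrite exprS -!mulr_sumr -mulrDr -mulrA mulrCA; congr (_ * _).
rewrite -big_split /= mulr_sumr; apply: eq_bigr => k _.
by rewrite aE bE; ring.
Qed.

Section dyadic_cells.
Context {R : realType}.
Implicit Types (x y : R) (j J k : nat).

(** Half-open like the two pieces of [psi], so that the cells of one level partition [[0, 1[] and
    the Haar functions are differences of their indicators. *)
Definition cell J k : set R := `[k%:R / 2 ^+ J, k.+1%:R / 2 ^+ J[%classic.

Lemma in_cell J k x : (x \in cell J k) = (k%:R <= 2 ^+ J * x < k.+1%:R).
Proof.
have p : 0 < 2 ^+ J :> R by rewrite exprn_gt0.
by rewrite mem_setE in_itv /= ler_pdivrMr // ltr_pdivlMr // [x * _]mulrC.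
Qed.

Lemma indic_cell J k x : \1_(cell J k) x = (k%:R <= 2 ^+ J * x < k.+1%:R)%R%:R :> R.
Proof. by rewrite indicE in_cell. Qed.

Lemma measurable_cell J k : measurable (cell J k).
Proof. exact: measurable_itv. Qed.

Lemma natr_dyadic k : [/\ k.+1%:R = k%:R + 1 :> R, k.*2%:R = 2 * k%:R :> R,
  k.*2.+1%:R = 2 * k%:R + 1 :> R & k.*2.+2%:R = 2 * k%:R + 2 :> R].
Proof.
have E : k.*2%:R = 2 * k%:R :> R by rewrite -mul2n natrM.
by rewrite -[k.+1%:R]natr1 -[k.*2.+2%:R]natr1 -[k.*2.+1%:R]natr1 E; split => //; ring.
Qed.

Lemma indic_cellS J k x :
  \1_(cell J k) x = \1_(cell J.+1 k.*2) x + \1_(cell J.+1 k.*2.+1) x :> R.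
Proof.
rewrite !indic_cell exprS -mulrA; set z := 2 ^+ J * x.
have [-> -> -> ->] := natr_dyadic k.
case: (leP k%:R z) => h1; case: (ltP z (k%:R + 1)) => h2 /=;
 case: (leP (2 * k%:R) (2 * z)) => h3; case: (ltP (2 * z) (2 * k%:R + 1)) => h4 /=;
 case: (leP (2 * k%:R + 1) (2 * z)) => h5; case: (ltP (2 * z) (2 * k%:R + 2)) => h6 /=;
 first [by rewrite ?addr0 ?add0r | exfalso; lra].
Qed.

Lemma haarE j k x : haar j k x =
  2 `^ (j%:R / 2) * (\1_(cell j.+1 k.*2) x - \1_(cell j.+1 k.*2.+1) x).
Proof.
rewrite /haar /psi !indic_cell !indicE !mem_setE !in_itv /= exprS.
rewrite -mulrA; set z := 2 ^+ j * x.
have [_ -> -> ->] := natr_dyadic k; congr (_ * (_%:R - _%:R)).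
  by congr (nat_of_bool (_ && _)); apply/idP/idP; lra.
by congr (nat_of_bool (_ && _)); apply/idP/idP; lra.
Qed.

Lemma haar_coef j : (2 `^ (j%:R / 2)) ^+ 2 = 2 ^+ j :> R.
Proof.
by rewrite -powR_mulrn ?powR_ge0 // -powRrM mulfVK // powR_mulrn.
Qed.

Lemma haar_kernel J x y :
  \sum_(j < J) \sum_(k < 2 ^ j) haar j k x * haar j k y =
  2 ^+ J * (\sum_(c < 2 ^ J) \1_(cell J c) x * \1_(cell J c) y)
  - \1_(cell 0 0) x * \1_(cell 0 0) y.
Proof.
have := sum_refinement (fun j k => indic_cellS j k x) (fun j k => indic_cellS j k y) J.
move <-; apply: eq_bigr => j _; apply: eq_bigr => k _.
by rewrite !haarE -haar_coef; ring.
Qed.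

End dyadic_cells.

Section counts.
Context {R : realType} {d : measure_display} {Omega : measurableType d}.
Variables (N : Omega -> nat) (X : nat -> Omega -> R).

Definition occupancy J (w : Omega) : {ffun 'I_(2 ^ J) -> nat} :=
  [ffun c : 'I_(2 ^ J) => count_in N X (cell J c) w].

Lemma natr_count_in (A : set R) w :
  (count_in N X A w)%:R = \sum_(l < N w) \1_A (X l w) :> R.
Proof. by rewrite natr_sum; apply: eq_bigr => l _; rewrite indicE. Qed.

Lemma count_cellS J k w : count_in N X (cell J k) w =
  (count_in N X (cell J.+1 k.*2) w + count_in N X (cell J.+1 k.*2.+1) w)%N.
Proof.
apply/eqP; rewrite -(eqr_nat R) natrD !natr_count_in -big_split /=; apply/eqP.
by apply: eq_bigr => l _; exact: indic_cellS.
Qed.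

Lemma total_occupancy J w : total (occupancy J w) = count_in N X (cell 0 0) w.
Proof.
rewrite /total; under eq_bigr do rewrite ffunE.
elim: J => [|J IH]; first by rewrite expn0 big_ord_recl big_ord0 addn0.
rewrite -IH expnS mul2n (big_ord_double _ _ (fun c => count_in N X (cell J.+1 c) w)).
by apply: eq_bigr => c _; rewrite [RHS]count_cellS.
Qed.

Lemma sum_off_diagonal n (g : 'I_n -> R) :
  \sum_l \sum_(l' | l' != l) g l * g l' = (\sum_l g l) ^+ 2 - \sum_l g l ^+ 2.
Proof.
apply/eqP; rewrite -subr_eq opprK expr2 big_distrl /= -big_split /=; apply/eqP.
apply: eq_bigr => l _; rewrite big_distrr /= [in RHS](bigD1 l) //= addrC.
by rewrite expr2.
Qed.

Lemma statE L J w :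
  stat N X L J w = (L ^+ 2)^-1 * collisions (occupancy J w).
Proof.
rewrite /stat; under eq_bigr do rewrite -mulr_sumr.
rewrite -mulr_sumr; congr (_ * _).
under eq_bigr => j _ do rewrite exchange_big.
rewrite exchange_big /=.
have -> : \sum_(l < N w) \sum_(j < J) \sum_(k < 2 ^ j) \sum_(l' < N w | l' != l)
    haar j k (X l w) * haar j k (X l' w) =
  \sum_(l < N w) \sum_(l' < N w | l' != l)
    (2 ^+ J * (\sum_(c < 2 ^ J) \1_(cell J c) (X l w) * \1_(cell J c) (X l' w))
      - \1_(cell 0 0) (X l w) * \1_(cell 0 0) (X l' w)).
  apply: eq_bigr => l _; under eq_bigr => j _ do rewrite exchange_big.
  by rewrite exchange_big; apply: eq_bigr => l' _ /=; rewrite haar_kernel.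
under eq_bigr do rewrite sumrB.
rewrite sumrB sum_off_diagonal; congr (_ - _); last first.
  rewrite total_occupancy natr_count_in; congr (_ - _).
  by apply: eq_bigr => l _; rewrite indicE expr2 -natrM mulnb andbb.
rewrite card_ord natrX; under eq_bigr do rewrite -mulr_sumr exchange_big.
rewrite -mulr_sumr exchange_big /=; congr (_ * _); apply: eq_bigr => c _.
rewrite sum_off_diagonal ffunE natr_count_in; congr (_ - _).
by apply: eq_bigr => l _; rewrite indicE expr2 -natrM mulnb andbb.
Qed.

End counts.

(** * Haar coefficients of bounded intensities *)

Lemma Rintegral_sum {R : realType} {d : measure_display} {T : measurableType d}
  (mu : {measure set T -> \bar R}) (D : set T) (I : Type) (r : seq I) (F : I -> T -> R) :
  measurable D -> (forall i, mu.-integrable D (EFin \o F i)) ->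
  \int[mu]_(x in D) (\sum_(i <- r) F i x) = \sum_(i <- r) \int[mu]_(x in D) F i x.
Proof.
move=> mD iF; elim: r => [|i r IH].
  by rewrite big_nil; under eq_Rintegral do rewrite big_nil; rewrite Rintegral_cst // mul0r.
rewrite big_cons -IH -RintegralD //; last first.
  have := @integrable_sum _ _ _ mu D mD _ r xpredT (fun i => EFin \o F i) (fun i _ => iF i).
  by apply: eq_integrable => // x _ /=; rewrite sumEFin.
by apply: eq_Rintegral => x _; rewrite big_cons.
Qed.

Section unit_interval_integral.
Context {R : realType}.
Local Notation mu := (@lebesgue_measure R).
Implicit Types (f g s : R -> R).

Lemma bounded_integrable01 f (K : R) : measurable_fun (`[0, 1] : set R) f ->
  (forall x : R, 0 <= x <= 1 -> `|f x| <= K) -> mu.-integrable `[0, 1] (EFin \o f).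
Proof.
move=> mf fK; apply: measurable_bounded_integrable => //.
  by rewrite /= lebesgue_measure_itv /= lte_fin ltr01 EFinN sube0 ltry.
exists K; split; first by rewrite num_real.
move=> K' KK' x /=; rewrite in_itv /= => x01; exact: le_trans (fK x x01) (ltW KK').
Qed.

Lemma Rintegral01_cst (a : R) : \int[mu]_(x in `[0, 1]) (fun=> a) x = a.
Proof.
by rewrite Rintegral_cst //= lebesgue_measure_itv /= lte_fin ltr01 EFinN sube0 mulr1.
Qed.

Lemma cell00 : cell 0 0 = `[0, 1[%classic :> set R.
Proof. by rewrite /cell expr0 !divr1. Qed.

Lemma cell_sub J k : (k < 2 ^ J)%N -> cell J k `<=` (`[0, 1[%classic : set R).
Proof.
move=> kJ x /mem_set; rewrite in_cell /= in_itv /= => /andP[kx xk].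
have p : 0 < 2 ^+ J :> R by rewrite exprn_gt0.
apply/andP; split; first by rewrite -(pmulr_rge0 _ p) (le_trans _ kx).
rewrite -(ltr_pM2l p) mulr1 (lt_le_trans xk) // -natrX ler_nat //.
Qed.

Lemma Rintegral_cell J k : (k < 2 ^ J)%N ->
  \int[mu]_(x in `[0, 1]) \1_(cell J k) x = (2 ^+ J)^-1.
Proof.
move=> kJ; rewrite /Rintegral integral_indic //; last exact: measurable_cell.
rewrite (_ : _ `&` _ = cell J k); last first.
  apply/seteqP; split => [x []//|x xk]; split => //.
  by have := cell_sub kJ xk; rewrite /= !in_itv /= => /andP[-> /ltW ->].
have p : 0 < (2 ^+ J)^-1 :> R by rewrite invr_gt0 exprn_gt0.
rewrite /cell /= lebesgue_measure_itv /= lte_fin ltr_pM2r // ltr_nat ltnSn /=.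
by rewrite -mulrBl -natr1 addrAC subrr add0r mul1r.
Qed.

Lemma sum_indic_cell J (x : R) : 0 <= x < 1 -> \sum_(c < 2 ^ J) \1_(cell J c) x = 1 :> R.
Proof.
move=> x01; elim: J => [|J IH].
  by rewrite expn0 big_ord_recl big_ord0 addr0 cell00 indicE mem_set.
rewrite -[RHS]IH expnS mul2n (big_ord_double _ _ (fun c => \1_(cell J.+1 c) x)) /=.
by apply: eq_bigr => c _; rewrite [RHS]indic_cellS.
Qed.

Definition mass s (A : set R) : R := \int[mu]_(x in A `&` `[0, 1]) s x.

Lemma massE s A : mass s A = \int[mu]_(x in `[0, 1]) (s x * \1_A x).
Proof.
rewrite /mass Rintegral_mkcondl; apply: eq_Rintegral => x _.
by rewrite patchE indicE; case: ifP => _; rewrite ?mulr1 ?mulr0.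
Qed.

(** Heine's theorem, from the covering form of compactness along the filter of small positive
    [eta]. *)
Lemma uniform_continuity01 g (eps : R) : continuous g -> 0 < eps ->
  exists2 eta : R, 0 < eta & forall x y : R, 0 <= x <= 1 -> `|x - y| < eta -> `|g x - g y| < eps.
Proof.
move=> cg e0.
have /compact_near_coveringP cov := @segment_compact R 0 1.
have := cov R (0^'+) (fun eta x => forall y, `|x - y| < eta -> `|g x - g y| < eps) _.
case.
- move=> x _.
  have /cvgrPdist_lt/(_ (eps / 2)) : g z @[z --> x] --> g x by exact: cg.
  rewrite divr_gt0 // => /(_ isT)/nbhs_ballP[r /= r0 gr].
  exists (ball x (r / 2), `]0, (r / 2)[%classic).
    split; first by apply: nbhsx_ballx; rewrite divr_gt0.
    near=> e; rewrite /= in_itv /=; apply/andP; split; near: e; first exact: nbhs_right_gt.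
    by apply: nbhs_right_lt; rewrite divr_gt0.
  move=> [z eta] /= [xz]; rewrite in_itv /= => /andP[_ er] y zy.
  have xy : ball x r y.
    rewrite /ball /= in xz *; have := ler_distD z x y; lra.
  have xz' : ball x r z by rewrite /ball /= in xz *; lra.
  have := gr _ xy; have := gr _ xz' => /= h1 h2.
  have := ler_distD (g x) (g z) (g y); rewrite [X in _ <= X + _]distrC; lra.
- move=> eta0 /= e00 h.
  exists (eta0 / 2) => /=; first by rewrite divr_gt0.
  move=> x y x01; apply: (h (eta0 / 2)) => /=.
  - by rewrite sub0r normrN gtr0_norm ?divr_gt0 //; move: e00 => /=; lra.
  - by rewrite divr_gt0.
  - by rewrite in_itv.
Unshelve. all: by end_near. Qed.

Section bounded_intensity.
Variables (s : R -> R) (M : R).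
Hypothesis ms : measurable_fun (`[0, 1] : set R) s.
Hypothesis s01 : forall x : R, 0 <= x <= 1 -> 0 <= s x <= M.

Lemma bound_ge0 : 0 <= M.
Proof.
have /s01/andP[s0 sM] : 0 <= (0 : R) <= 1 by rewrite lexx ler01.
exact: le_trans s0 sM.
Qed.

Lemma integrable01_intensity : mu.-integrable `[0, 1] (EFin \o s).
Proof.
by apply: (@bounded_integrable01 _ M ms) => x /s01/andP[s0 sM]; rewrite ger0_norm.
Qed.

Lemma integrable01_sqr : mu.-integrable `[0, 1] (EFin \o (fun x => s x * s x)).
Proof.
apply: (@bounded_integrable01 _ (M * M)); first exact: measurable_funM.
by move=> x /s01/andP[s0 sM]; rewrite normrM ger0_norm // ler_pM.
Qed.

Lemma integrable01_indic A : measurable A ->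
  mu.-integrable `[0, 1] (EFin \o (fun x => s x * \1_A x)).
Proof.
move=> mA; apply: (@bounded_integrable01 _ M).
  by apply: measurable_funM => //; exact: measurable_indic.
move=> x /s01/andP[s0 sM]; rewrite normrM ger0_norm // indicE.
by case: (_ \in _); rewrite ?normr1 ?normr0 ?mulr1 ?mulr0 // bound_ge0.
Qed.

Lemma mass_cellS J k :
  mass s (cell J k) = mass s (cell J.+1 k.*2) + mass s (cell J.+1 k.*2.+1).
Proof.
have i k' := integrable01_indic (measurable_cell J.+1 k').
rewrite !massE -(RintegralD _ (i _) (i _)) //.
by apply: eq_Rintegral => x _; rewrite indic_cellS mulrDr.
Qed.

Lemma inner_haar j k : inner s (haar j k) =
  2 `^ (j%:R / 2) * (mass s (cell j.+1 k.*2) - mass s (cell j.+1 k.*2.+1)).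
Proof.
have i k' := integrable01_indic (measurable_cell j.+1 k').
rewrite /inner !massE -(RintegralB _ (i _) (i _)) //.
have iB : mu.-integrable `[0, 1] (EFin \o (fun x => s x * \1_(cell j.+1 k.*2) x -
    s x * \1_(cell j.+1 k.*2.+1) x)).
  by apply: (integrableB _ (i k.*2) (i k.*2.+1)).
by rewrite -(RintegralZl _ _ iB) //; apply: eq_Rintegral => x _; rewrite haarE; ring.
Qed.

Definition energy J : R := \sum_(j < J) \sum_(k < 2 ^ j) inner s (haar j k) ^+ 2.

Lemma energyE J : energy J =
  2 ^+ J * (\sum_(c < 2 ^ J) mass s (cell J c) ^+ 2) - mass s (cell 0 0) ^+ 2.
Proof.
rewrite expr2; under [X in _ * X]eq_bigr do rewrite expr2.
rewrite -(sum_refinement mass_cellS mass_cellS); apply: eq_bigr => j _.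
by apply: eq_bigr => k _; rewrite inner_haar -haar_coef; ring.
Qed.

Lemma energy_le J J' : (J <= J')%N -> energy J <= energy J'.
Proof.
move=> JJ'; rewrite /energy.
rewrite -!(big_mkord xpredT (fun j => \sum_(k < 2 ^ j) inner s (haar j k) ^+ 2)).
rewrite (big_cat_nat (leq0n _) JJ') /= lerDl sumr_ge0 // => j _.
by rewrite sumr_ge0 // => k _; exact: sqr_ge0.
Qed.

Lemma energy_ge0 J : 0 <= energy J.
Proof. by rewrite sumr_ge0 // => j _; rewrite sumr_ge0 // => k _; exact: sqr_ge0. Qed.

Lemma mass_cell_le J k : (k < 2 ^ J)%N -> mass s (cell J k) <= M / 2 ^+ J.
Proof.
move=> kJ; have i : mu.-integrable `[0, 1] (EFin \o (\1_(cell J k) : R -> R)).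
  apply: (@bounded_integrable01 _ 1); first exact: (measurable_indic (measurable_cell J k)).
  by move=> x _; rewrite indicE; case: (_ \in _); rewrite ?normr1 ?normr0.
rewrite massE -(Rintegral_cell kJ) -(RintegralZl _ _ i) //.
apply: le_Rintegral => //; first exact: (integrable01_indic (measurable_cell J k)).
  apply: (@bounded_integrable01 _ M).
    by apply: measurable_funM => //; exact: (measurable_indic (measurable_cell J k)).
  move=> x _; rewrite indicE; have M0 := bound_ge0.
  by case: (_ \in _); rewrite ?mulr1 ?mulr0 ?normr0 // ger0_norm.
move=> x /=; rewrite in_itv /= => /s01/andP[_ sM].
by apply: ler_wpM2r => //; rewrite indicE ler0n.
Qed.

Lemma mass00 : mass s (cell 0 0) = \int[mu]_(x in `[0, 1]) s x.
Proof.
rewrite /mass (_ : _ `&` _ = `[0, 1[%classic); last first.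
  rewrite cell00; apply/seteqP; split => [x []//|x x01]; split => //.
  by move: x01; rewrite /= !in_itv /= => /andP[-> /ltW ->].
rewrite Rintegral_itv_bndo_bndc //; apply: integrableS integrable01_intensity => //.
by move=> x /=; rewrite !in_itv /= => /andP[-> /ltW ->].
Qed.

(** The infimum is at most its value at the constant function equal to the mean of [s]. *)
Lemma l2dist_le : l2dist s constant_functions ^+ 2 <=
  \int[mu]_(x in `[0, 1]) (s x * s x) - mass s (cell 0 0) ^+ 2.
Proof.
set m := mass s (cell 0 0).
set S := [set l2norm (fun x => s x - f x) | f in constant_functions].
have lb : lbound S 0 by move=> _ [f _ <-]; exact: sqrtr_ge0.
have Sm : S (l2norm (fun x => s x - m)).
  by exists (fun=> m) => //; exists m.
have d0 : 0 <= l2dist s constant_functions.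
  by apply: lb_le_inf => //; exists (l2norm (fun x => s x - m)).
have dm : l2dist s constant_functions <= l2norm (fun x => s x - m).
  by apply: inf_lbound => //; exists 0.
apply: (@le_trans _ _ (l2norm (fun x => s x - m) ^+ 2)).
  by rewrite ler_sqr ?nnegrE // (le_trans d0).
rewrite sqr_sqrtr; last by apply: Rintegral_ge0 => x _; rewrite -expr2 sqr_ge0.
have i1 : mu.-integrable `[0, 1] (EFin \o (fun x => (2 * m) * s x)).
  apply: (@bounded_integrable01 _ (`|2 * m| * M)); first exact: measurable_funM.
  by move=> x /s01/andP[s0 sM]; rewrite normrM (ger0_norm s0) ler_wpM2l.
have i2 : mu.-integrable `[0, 1] (EFin \o (fun x => s x * s x - (2 * m) * s x)).
  by apply: (integrableB _ integrable01_sqr i1).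
have i3 : mu.-integrable `[0, 1] (EFin \o (fun=> m ^+ 2)).
  by apply: (@bounded_integrable01 _ `|m ^+ 2|).
rewrite /inner (_ : (fun x => _) = (fun x => (s x * s x - (2 * m) * s x) + m ^+ 2)); last first.
  by apply/funext => x; ring.
rewrite RintegralD // RintegralB //; last exact: integrable01_sqr.
rewrite RintegralZl //; last exact: integrable01_intensity.
rewrite Rintegral01_cst -mass00 -/m le_eqVlt; apply/orP; left; apply/eqP; ring.
Qed.

(** Serves to discard small [L], for which the separation hypothesis would contradict this bound. *)
Lemma l2dist_le_bound : l2dist s constant_functions ^+ 2 <= M ^+ 2.
Proof.
apply: le_trans l2dist_le _; apply: (@le_trans _ _ (\int[mu]_(x in `[0, 1]) (s x * s x))).
  by rewrite gerBl sqr_ge0.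
rewrite -[leRHS]Rintegral01_cst; apply: le_Rintegral => //; first exact: integrable01_sqr.
  exact: (@bounded_integrable01 _ `|M ^+ 2|).
by move=> x /=; rewrite in_itv /= => /s01/andP[s0 sM]; rewrite expr2 ler_pM.
Qed.

End bounded_intensity.
End unit_interval_integral.

(** * Completeness of the Haar basis and bias on Besov balls *)

Section haar_completeness.
Context {R : realType}.
Local Notation mu := (@lebesgue_measure R).
Variables (s : R -> R) (M : R).
Hypothesis ms : measurable_fun (`[0, 1] : set R) s.
Hypothesis s01 : forall x : R, 0 <= x <= 1 -> 0 <= s x <= M.

(** The comparison leaves out the point 1, which belongs to no cell. *)
Lemma Rintegral01_le (f g : R -> R) :
  mu.-integrable `[0, 1] (EFin \o f) -> mu.-integrable `[0, 1] (EFin \o g) ->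
  (forall x, 0 <= x < 1 -> f x <= g x) ->
  \int[mu]_(x in `[0, 1]) f x <= \int[mu]_(x in `[0, 1]) g x.
Proof.
move=> fi gi fg.
have sub : `[0, 1[%classic `<=` (`[0, 1]%classic : set R).
  by move=> x /=; rewrite !in_itv /= => /andP[-> /ltW ->].
have i (k : R -> R) : mu.-integrable `[0, 1] (EFin \o k) -> mu.-integrable `[0, 1[ (EFin \o k).
  exact: integrableS.
rewrite -!Rintegral_itv_bndo_bndc; [|exact: i..].
apply: le_Rintegral; [by []|exact: i|exact: i|].
by move=> x /=; rewrite in_itv /=; exact: fg.
Qed.

(* For any values [h c] on the cells, [2^J sum_c p_c^2 >= int (2 s h - h^2)]; the left side is thus
   at least [int s^2 - int (s - h)^2], with [h] interpolating a continuous approximation of [s]. *)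
Lemma haar_complete (eps : R) : 0 < eps -> exists J,
  \int[mu]_(x in `[0, 1]) (s x * s x) <=
  2 ^+ J * (\sum_(c < 2 ^ J) mass s (cell J c) ^+ 2) + eps.
Proof.
move=> eps0; have M0 := bound_ge0 s01.
(* The error is [M * e] from the integral of [|s - g|] and [M * e] from the oscillation of [g] on a
   cell. The denominator has [M + 1] because [M] may be 0. *)
pose e := eps / (2 * (M + 1)).
have e0 : 0 < e by rewrite divr_gt0 // mulr_gt0 //; lra.
have is1 := integrable01_intensity ms s01.
have [g [gc gi gs]] : exists g : R -> R, [/\ continuous g, mu.-integrable `[0, 1] (EFin \o g) &
    \int[mu]_(x in `[0, 1]) `|s x - g x| <= e].
  have mu01 : (mu `[0%R, 1%R] < +oo)%E.
    by rewrite /= lebesgue_measure_itv /= lte_fin ltr01 EFinN sube0 ltry.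
  have [g_ [gc gi gs]] :=
    @approximation_continuous_integrable R `[0, 1] s (measurable_itv _) mu01 is1.
  have /fine_cvgP[_ /cvgrPdist_le /(_ e e0)[n _ /(_ n (leqnn n))]] := gs.
  rewrite /= sub0r normrN => gn; exists (g_ n); split => //.
  by apply: le_trans gn; exact: ler_norm.
have [eta eta0 geta] := uniform_continuity01 gc e0.
have [J Jeta] : exists J, (2 ^+ J)^-1 < eta.
  exists (Num.truncn (eta^-1)).+1.
  rewrite -[X in _ < X]invrK ltf_pV2 ?posrE ?invr_gt0 ?exprn_gt0 //.
  apply: lt_le_trans (truncnS_gt _) _; rewrite -natrX ler_nat.
  exact: ltnW (ltn_expl _ _).
exists J.
have D0 : 0 < 2 ^+ J :> R by rewrite exprn_gt0.
(* Clamping to [[0, M]], where [s] takes its values, brings [h c] no farther from [s x] and ensures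
   [|s x - h c| <= M]. The squared error is then at most [M * (|s x - g x| + e)], which is linear in
   the [L^1] error. *)
pose h (c : 'I_(2 ^ J)) : R := Num.min M (Num.max 0 (g (c%:R / 2 ^+ J))).
have h0 c : 0 <= h c <= M.
  by rewrite /h le_min M0 le_max lexx /= ge_min lexx.
have ind1 c : mu.-integrable `[0, 1] (EFin \o (\1_(cell J c) : R -> R)).
  apply: (@bounded_integrable01 _ _ 1); first exact: (measurable_indic (measurable_cell J c)).
  by move=> x _; rewrite indicE; case: (_ \in _); rewrite ?normr1 ?normr0.
have ind2 c := integrable01_indic ms s01 (measurable_cell J c).
pose F c x : R := 2 * h c * (s x * \1_(cell J c) x) - h c ^+ 2 * \1_(cell J c) x.
have a1 c : mu.-integrable `[0, 1] (EFin \o (fun x => 2 * h c * (s x * \1_(cell J c) x))).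
  by apply: (integrableZl _ (2 * h c) (ind2 c)).
have a2 c : mu.-integrable `[0, 1] (EFin \o (fun x => h c ^+ 2 * \1_(cell J c) x)).
  by apply: (integrableZl _ (h c ^+ 2) (ind1 c)).
have Fi c : mu.-integrable `[0, 1] (EFin \o F c) by apply: (integrableB _ (a1 c) (a2 c)).
have intF c : \int[mu]_(x in `[0, 1]) F c x = 2 * h c * mass s (cell J c) - h c ^+ 2 / 2 ^+ J.
  rewrite RintegralB // RintegralZl // RintegralZl // Rintegral_cell // massE //.
have sgi : mu.-integrable `[0, 1] (EFin \o (fun x => M * `|s x - g x|)).
  have := integrableZl _ M (integrable_norm (integrableB _ is1 gi)); apply => //.
have ci : mu.-integrable `[0, 1] (EFin \o (fun _ : R => M * e)).
  exact: (@bounded_integrable01 _ _ `|M * e|).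
have si : mu.-integrable `[0, 1] (EFin \o (fun x => M * `|s x - g x| + M * e)).
  by apply: (integrableD _ sgi ci).
have sFi : mu.-integrable `[0, 1] (EFin \o (fun x => \sum_c F c x)).
  have := @integrable_sum _ _ _ mu `[0, 1] (measurable_itv _) _ (index_enum 'I_(2 ^ J)) xpredT
    (fun c => EFin \o F c) (fun c _ => Fi c).
  by apply: eq_integrable => // x _ /=; rewrite sumEFin.
have key : \int[mu]_(x in `[0, 1]) (s x * s x) <=
    \int[mu]_(x in `[0, 1]) (\sum_c F c x + (M * `|s x - g x| + M * e)).
  apply: Rintegral01_le; first exact: integrable01_sqr ms s01.
    by apply: (integrableD _ sFi si).
  move=> x x01; have x01' : 0 <= x <= 1 by case/andP: x01 => -> /ltW ->.
  have E (y : R) : y = \sum_(c < 2 ^ J) \1_(cell J c) x * y.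
    by rewrite -mulr_suml sum_indic_cell // mul1r.
  rewrite (E (s x * s x)) (E (M * `|s x - g x| + M * e)) -big_split /=.
  apply: ler_sum => c _; rewrite /F indicE.
  case: (boolP (x \in cell J c)) => [xc|_] /=; last by rewrite !mul0r !mulr0 subrr addr0.
  rewrite !mul1r !mulr1 -lerBlDl.
  have -> : s x * s x - (2 * h c * s x - h c ^+ 2) = `|s x - h c| ^+ 2.
    by rewrite real_normK ?num_real //; ring.
  have /andP[s0 sM] := s01 x01'; have /andP[hc0 hcM] := h0 c.
  have sh : `|s x - h c| <= M by rewrite ler_norml; lra.
  have shg : `|s x - h c| <= `|s x - g (c%:R / 2 ^+ J)|.
    rewrite /h; set y := g _.
    have [yM|My] := leP M y; have [y0|y0] := leP 0 y.
    - by rewrite min_l // ler0_norm ?ler0_norm; lra.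
    - lra.
    - by rewrite min_r // ltW.
    - by rewrite min_r // subr0 !ger0_norm; lra.
  have gg : `|g x - g (c%:R / 2 ^+ J)| < e.
    apply: geta => //; apply: le_lt_trans Jeta.
    move: xc; rewrite in_cell -natr1 => /andP[cx xc].
    rewrite -(ler_pM2l D0) mulfV ?gt_eqF // -[2 ^+ J in X in X * _]gtr0_norm // -normrM.
    rewrite mulrBr mulrCA mulfV ?gt_eqF // mulr1.
    by rewrite ler_norml; lra.
  rewrite expr2 -mulrDr; apply: ler_pM => //.
  by have := ler_distD (g x) (s x) (g (c%:R / 2 ^+ J)); lra.
apply: le_trans key _; rewrite RintegralD // RintegralD // Rintegral01_cst.
rewrite Rintegral_sum // RintegralZl //; last exact: (integrable_norm (integrableB _ is1 gi)).
have Me : 2 * (M * e) <= eps.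
  rewrite mulrA [2 * M]mulrC -mulrA.
  have -> : 2 * e = eps / (M + 1) by rewrite /e; field; apply/eqP; lra.
  by rewrite mulrA ler_pdivrMr; nra.
apply: lerD; last first.
  apply: le_trans Me; rewrite mulr_natl mulr2n lerD2r; exact: ler_wpM2l M0 _ _ gs.
rewrite mulr_sumr; apply: ler_sum => c _; rewrite intF -subr_ge0.
have -> : 2 ^+ J * mass s (cell J c) ^+ 2 - (2 * h c * mass s (cell J c) - h c ^+ 2 / 2 ^+ J) =
  (2 ^+ J * mass s (cell J c) - h c) ^+ 2 / 2 ^+ J by field; rewrite gt_eqF.
by rewrite divr_ge0 ?sqr_ge0 // ltW.
Qed.

Lemma besov_dist (delta r : R) J : 0 < delta -> besov_ball delta r s ->
  l2dist s constant_functions ^+ 2 <=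
  energy s J + r ^+ 2 * (1 - 2 `^ (- (2 * delta)))^-1 * (2 ^+ J) `^ (- (2 * delta)).
Proof.
move=> d0 [_ sB]; set q := 2 `^ (- (2 * delta)).
have q0 : 0 < q by rewrite powR_gt0.
have q1 : q < 1.
  rewrite /q powRN invf_lt1 ?powR_gt0 //.
  apply: (@le_lt_trans _ _ (1 `^ (2 * delta))); first by rewrite powR1.
  by apply: gt0_ltr_powR; rewrite ?nnegrE //; lra.
have qE j : 2 `^ (- (2 * j%:R * delta)) = q ^+ j.
  rewrite -powR_mulrn ?ltW // -powRrM; congr (_ `^ _); ring.
have -> : (2 ^+ J) `^ (- (2 * delta)) = q ^+ J.
  rewrite -qE -powR_mulrn // -powRrM; congr (_ `^ _); ring.
(* The partial geometric sum of the Besov bounds, in the closed form that the induction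
   reproduces. *)
have tail n : energy s (J + n) <= energy s J + r ^+ 2 * (1 - q)^-1 * (q ^+ J - q ^+ (J + n)).
  elim: n => [|n IH]; first by rewrite addn0 subrr mulr0 addr0.
  rewrite addnS /energy big_ord_recr /=.
  have := sB (J + n)%N; rewrite qE => sBn.
  apply: le_trans (lerD IH sBn) _.
  rewrite -addrA lerD2l -subr_ge0 [q ^+ _.+1]exprS.
  set y := q ^+ (J + n).
  rewrite [X in 0 <= X](_ : _ = 0) //; field.
  by rewrite subr_eq0 eq_sym lt_eqF.
(* Completeness gives some level [J'] for each [eps]; as [energy] is nondecreasing, [J + J'] does as
   well. *)
apply/ler_addgt0Pr => eps eps0.
have [J' J'P] := haar_complete eps0.
apply: le_trans (l2dist_le ms s01) _.
have := energyE ms s01 J'; have := energy_le s (leq_addl J J').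
have := tail J'.
have : 0 <= r ^+ 2 * (1 - q)^-1 * q ^+ (J + J').
  apply: mulr_ge0; last by rewrite exprn_ge0 // ltW.
  by rewrite mulr_ge0 ?sqr_ge0 // invr_ge0 subr_ge0 ltW.
by move: J'P; lra.
Qed.

End haar_completeness.

(** * Poisson counts *)

Section nat_valued.
Context {R : realType} {d : measure_display} {Omega : measurableType d}.
Variable P : probability Omega R.
Implicit Types (K : Omega -> nat) (D : set Omega).

Lemma measurable_preimage_nat K (B : set nat) :
  measurable_fun setT K -> measurable (K @^-1` B).
Proof. by move=> mK; rewrite -[X in measurable X]setTI; exact: mK. Qed.

Lemma measurable_comp_nat {d'} {T : measurableType d'} D K (g : nat -> T) :
  measurable_fun setT K -> measurable_fun D (fun w => g (K w)).
Proof.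
move=> mK; apply: measurable_funTS => _ B mB; rewrite setTI.
exact: (measurable_preimage_nat (g @^-1` B)).
Qed.

Lemma ge0_integral_nat D K (g : nat -> \bar R) :
  measurable D -> measurable_fun setT K -> (forall k, (0 <= g k)%E) ->
  (\int[P]_(w in D) g (K w) = \sum_(k <oo) g k * P (D `&` K @^-1` [set k]))%E.
Proof.
move=> mD mK g0.
have mF k : measurable (D `&` K @^-1` [set k]).
  by apply: measurableI => //; exact: measurable_preimage_nat.
have DE : D = \bigcup_k (D `&` K @^-1` [set k]).
  by apply/seteqP; split => [w Dw|w [k _ []]//]; exists (K w).
rewrite {1}DE ge0_integral_bigcup //; last 2 first.
- exact: measurable_comp_nat.
- by move=> i j _ _ [w [[_ /= <-] [_ /= <-]]].
apply: eq_eseriesr => k _.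
rewrite (eq_integral (fun=> g k)); last by move=> w /set_mem[_ /= ->].
by rewrite integral_cst.
Qed.

(** For variables with values in [nat], independence on atoms suffices: the integral is cut along
    the values of [K2], then of [K1]. *)
Lemma ge0_integral_indep K1 K2 (f g : nat -> \bar R) :
  measurable_fun setT K1 -> measurable_fun setT K2 ->
  (forall i j, P (K1 @^-1` [set i] `&` K2 @^-1` [set j]) =
     (P (K1 @^-1` [set i]) * P (K2 @^-1` [set j]))%E) ->
  (forall k, (0 <= f k)%E) -> (forall k, (0 <= g k)%E) ->
  (\int[P]_w f (K1 w))%E \is a fin_num ->
  (\int[P]_w (f (K1 w) * g (K2 w)) = (\int[P]_w f (K1 w)) * (\int[P]_w g (K2 w)))%E.
Proof.
move=> m1 m2 ind f0 g0 ffin.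
have mE j : measurable (K2 @^-1` [set j]) by exact: measurable_preimage_nat.
have UE : [set: Omega] = \bigcup_j (K2 @^-1` [set j]).
  by apply/seteqP; split => w // _; exists (K2 w).
rewrite [in LHS]UE ge0_integral_bigcup //; last 3 first.
- rewrite -UE; apply: emeasurable_funM; exact: measurable_comp_nat.
- by move=> w _; rewrite mule_ge0.
- by move=> i j _ _ [w [/= <- <-]].
rewrite [X in (_ * X)%E]ge0_integral_nat //.
have I0 : (0 <= \int[P]_w f (K1 w))%E by exact: integral_ge0.
transitivity (\sum_(k <oo)
  ((\int[P]_w f (K1 w)) * (g k * P ([set: Omega] `&` K2 @^-1` [set k]))))%E.
  apply: eq_eseriesr => k _.
  rewrite (eq_integral (fun w => g k * f (K1 w))%E); last first.
    by move=> w /set_mem /= ->; rewrite muleC.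
  rewrite ge0_integralZl //; last exact: measurable_comp_nat.
  rewrite muleCA; congr (_ * _)%E; rewrite setTI.
  rewrite !ge0_integral_nat // muleC.
  have := fineK (fin_num_measure P _ (mE k)) => <-.
  rewrite -nneseriesZl //; last by move=> i _; rewrite mule_ge0.
  apply: eq_eseriesr => i _; rewrite setTI setIC ind fineK ?fin_num_measure //.
  by rewrite [RHS]muleCA; congr (_ * _)%E; exact: muleC.
rewrite -(fineK ffin) nneseriesZl //.
by move=> k _; rewrite mule_ge0.
Qed.

Lemma Rintegral_indep K1 K2 (f g : nat -> R) :
  measurable_fun setT K1 -> measurable_fun setT K2 ->
  (forall i j, P (K1 @^-1` [set i] `&` K2 @^-1` [set j]) =
     (P (K1 @^-1` [set i]) * P (K2 @^-1` [set j]))%E) ->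
  P.-integrable setT (fun w => (f (K1 w))%:E) ->
  P.-integrable setT (fun w => (g (K2 w))%:E) ->
  P.-integrable setT (fun w => (f (K1 w) * g (K2 w))%:E) /\
  \int[P]_w (f (K1 w) * g (K2 w)) = (\int[P]_w f (K1 w)) * (\int[P]_w g (K2 w)).
Proof.
move=> m1 m2 ind fi gi.
have pos (a b : nat -> R) : (forall k, 0 <= a k) -> (forall k, 0 <= b k) ->
  P.-integrable setT (fun w => (a (K1 w))%:E) -> P.-integrable setT (fun w => (b (K2 w))%:E) ->
  P.-integrable setT (fun w => (a (K1 w) * b (K2 w))%:E) /\
  \int[P]_w (a (K1 w) * b (K2 w)) = (\int[P]_w a (K1 w)) * (\int[P]_w b (K2 w)).
  move=> a0 b0 ai bi.
  have fa := integrable_fin_num measurableT ai.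
  have E := @ge0_integral_indep K1 K2 (EFin \o a) (EFin \o b) m1 m2 ind a0 b0 fa.
  have fb := integrable_fin_num measurableT bi.
  split; last by rewrite /Rintegral -fineM // -E.
  apply/integrableP; split.
    by apply/measurable_EFinP/measurable_funM; exact: measurable_comp_nat.
  rewrite (eq_integral (fun w => (a (K1 w))%:E * (b (K2 w))%:E)%E); last first.
    by move=> w _; rewrite gee0_abs // lee_fin mulr_ge0.
  by rewrite E ltey_eq fin_numM.
pose p (h : nat -> R) k := Num.max (h k) 0.
pose m (h : nat -> R) k := Num.max (- h k) 0.
have hE (h : nat -> R) k : h k = p h k - m h k.
  by rewrite /p /m; case: (leP (h k) 0) => h0; [rewrite max_l|rewrite max_r]; lra.
have p0 h k : 0 <= p h k by rewrite le_max lexx orbT.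
have m0 h k : 0 <= m h k by rewrite le_max lexx orbT.
have pi h K : measurable_fun setT K -> P.-integrable setT (fun w => (h (K w))%:E) ->
    P.-integrable setT (fun w => (p h (K w))%:E).
  move=> mK; apply: le_integrable => //.
    by apply/measurable_EFinP; exact: measurable_comp_nat.
  move=> w _ /=; rewrite lee_fin /p; case: (leP (h (K w)) 0) => h0; rewrite ?normr0 //.
have mi h K : measurable_fun setT K -> P.-integrable setT (fun w => (h (K w))%:E) ->
    P.-integrable setT (fun w => (m h (K w))%:E).
  move=> mK; apply: le_integrable => //.
    by apply/measurable_EFinP; exact: measurable_comp_nat.
  move=> w _ /=; rewrite lee_fin /m; case: (leP (- h (K w)) 0) => h0; rewrite ?normr0 ?normrN //.
have [i1 e1] := pos _ _ (p0 f) (p0 g) (pi _ _ m1 fi) (pi _ _ m2 gi).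
have [i2 e2] := pos _ _ (p0 f) (m0 g) (pi _ _ m1 fi) (mi _ _ m2 gi).
have [i3 e3] := pos _ _ (m0 f) (p0 g) (mi _ _ m1 fi) (pi _ _ m2 gi).
have [i4 e4] := pos _ _ (m0 f) (m0 g) (mi _ _ m1 fi) (mi _ _ m2 gi).
have i12 := integrableB measurableT i1 i2.
have i34 := integrableB measurableT i3 i4.
have -> : (fun w => f (K1 w) * g (K2 w)) = (fun w =>
   (p f (K1 w) * p g (K2 w) - p f (K1 w) * m g (K2 w)) -
   (m f (K1 w) * p g (K2 w) - m f (K1 w) * m g (K2 w))).
  by apply/funext => w; rewrite (hE f) (hE g); ring.
split.
  have := integrableB measurableT i12 i34; apply: eq_integrable => // w _ /=.
  by rewrite -?EFinB (hE f) (hE g); congr EFin; ring.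
rewrite !RintegralB // e1 e2 e3 e4.
have -> : (fun w => f (K1 w)) = (fun w => p f (K1 w) - m f (K1 w)) by apply/funext => w.
have -> : (fun w => g (K2 w)) = (fun w => p g (K2 w) - m g (K2 w)) by apply/funext => w.
rewrite !RintegralB //; first by ring.
all: by [apply: pi|apply: mi].
Qed.

Lemma chebyshev_sqr (Y : Omega -> R) (v e : R) : measurable_fun setT Y -> 0 < e ->
  (\int[P]_w (Y w ^+ 2)%:E <= v%:E)%E -> (P [set w | (e <= `|Y w|)%R] <= (v / e ^+ 2)%:E)%E.
Proof.
move=> mY e0 Yv.
have mA : measurable [set w | e <= `|Y w|].
  have mN : measurable_fun setT (fun w => `|Y w|) by exact: measurableT_comp.
  have -> : [set w | e <= `|Y w|] = setT `&` (fun w => `|Y w|) @^-1` `[e, +oo[.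
    by apply/seteqP; split => w /=; rewrite in_itv /= andbT // => -[].
  exact: mN (measurable_itv _).
rewrite mulrC EFinM lee_pdivlMl ?exprn_gt0 //; apply: le_trans Yv.
rewrite -[X in (_ * P X)%E]setIT -integral_indic // -ge0_integralZl //; last 2 first.
  by apply/measurable_EFinP; exact: measurable_indic.
  by rewrite lee_fin exprn_ge0 // ltW.
apply: ge0_le_integral => //.
- by move=> w _; rewrite -EFinM lee_fin mulr_ge0 // exprn_ge0 // ltW.
- apply/measurable_EFinP; apply: measurable_funM => //; exact: measurable_indic.
- by apply/measurable_EFinP; exact: (measurable_funM mY mY).
move=> w _; rewrite -EFinM lee_fin indicE; case: (boolP (w \in _)) => [/set_mem /= ew|_].
  by rewrite mulr1 -[leRHS]real_normK ?num_real // ler_sqr ?nnegrE // ltW.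
by rewrite mulr0 sqr_ge0.
Qed.

End nat_valued.

Section poisson_moments.
Context {R : realType} {d : measure_display} {Omega : measurableType d}.
Variable P : probability Omega R.

Definition poisson_count (K : Omega -> nat) (m : R) : Prop :=
  forall B : set nat, P (K @^-1` B) = poisson_prob m 0 B.

Variables (K : Omega -> nat) (m : R).
Hypothesis mK : measurable_fun setT K.
Hypothesis m0 : 0 <= m.
Hypothesis Km : poisson_count K m.

Lemma poisson_count1 k : P (K @^-1` [set k]) = (m ^+ k * k`!%:R^-1 * expR (- m))%:E.
Proof.
rewrite Km /poisson_prob; case: ltP => [m1|m1].
  by rewrite esum_set1 ?lee_fin ?poisson_pmf_ge0 // /poisson_pmf m1.
(* For [m = 0] the law is the Dirac mass at 0, which agrees with the formula since [0 ^+ 0 = 1]. *)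
have -> : m = 0 by apply/le_anti; rewrite m1.
rewrite diracE oppr0 expR0 mulr1; case: k => [|k].
  by rewrite mem_set // expr0 fact0 invr1 mulr1.
by rewrite memNset //= expr0n mul0r.
Qed.

(** The Chen-Stein identity, from [k P(K = k) = m P(K = k - 1)]. Integrability is part of the
    conclusion, so that it passes from one power of [K] to the next. *)
Lemma poisson_stein (g : nat -> R) : (forall k, 0 <= g k) ->
  P.-integrable setT (fun w => (g (K w).+1)%:E) ->
  P.-integrable setT (fun w => ((K w)%:R * g (K w))%:E) /\
  \int[P]_w ((K w)%:R * g (K w)) = m * \int[P]_w g (K w).+1.
Proof.
move=> g0 gi.
have E : (\int[P]_w ((K w)%:R * g (K w))%:E = m%:E * \int[P]_w (g (K w).+1)%:E)%E.
  rewrite (ge0_integral_nat P measurableT mK (g := fun k => (k%:R * g k)%:E)); last first.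
    by move=> k; rewrite lee_fin mulr_ge0.
  rewrite (ge0_integral_nat P measurableT mK (g := fun k => (g k.+1)%:E)); last first.
    by move=> k; rewrite lee_fin.
  rewrite -nneseriesZl //; last by move=> k _; rewrite mule_ge0 // lee_fin.
  rewrite nneseries_recl //; last by move=> k _; rewrite mule_ge0 // lee_fin mulr_ge0.
  rewrite mul0r mul0e add0e -(nneseries_addn 1); last first.
    by move=> k; rewrite mule_ge0 // lee_fin mulr_ge0.
  apply: eq_eseriesr => k _; rewrite addn1 !setTI !poisson_count1 -!EFinM; congr EFin.
  have f0 : k`!%:R != 0 :> R by rewrite pnatr_eq0 -lt0n fact_gt0.
  have k0 : k.+1%:R != 0 :> R by rewrite pnatr_eq0.
  rewrite factS natrM exprS; rewrite -natr1 addrC in k0 *.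
  by field; rewrite f0.
have gf := integrable_fin_num measurableT gi.
split; last by rewrite /Rintegral E fineM.
apply/integrableP; split.
  by apply/measurable_EFinP; exact: (measurable_comp_nat (fun k => k%:R * g k) mK).
rewrite (eq_integral (fun w => ((K w)%:R * g (K w))%:E)); last first.
  by move=> w _; rewrite gee0_abs // lee_fin mulr_ge0.
by rewrite E ltey_eq fin_numM.
Qed.

Lemma Rintegral_lincomb n (a : nat -> R) (Y : nat -> Omega -> R) :
  (forall p, (p < n)%N -> P.-integrable setT (EFin \o Y p)) ->
  P.-integrable setT (fun w => (\sum_(p < n) a p * Y p w)%:E) /\
  \int[P]_w (\sum_(p < n) a p * Y p w) = \sum_(p < n) a p * \int[P]_w Y p w.
Proof.
move=> Yi.
have i (p : 'I_n) : P.-integrable setT (EFin \o (fun w => a p * Y p w)).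
  by apply: (integrableZl _ (a p) (Yi p (ltn_ord p))).
split.
  have := @integrable_sum _ _ _ P setT measurableT _ (index_enum 'I_n) xpredT _ (fun p _ => i p).
  by apply: eq_integrable => // w _ /=; rewrite sumEFin.
rewrite Rintegral_sum //; apply: eq_bigr => p _.
by rewrite RintegralZl //; exact: Yi.
Qed.

(** The Chen-Stein identity for [g k = k ^+ p], with [(K + 1) ^+ p] expanded by the binomial
    formula. *)
Lemma poisson_moments p :
  P.-integrable setT (EFin \o (fun w => (K w)%:R ^+ p)) /\
  \int[P]_w ((K w)%:R ^+ p.+1) = m * \sum_(i < p.+1) 'C(p, i)%:R * \int[P]_w ((K w)%:R ^+ i).
Proof.
pose Y i w : R := (K w)%:R ^+ i.
have SE q w : (K w).+1%:R ^+ q = \sum_(i < q.+1) 'C(q, i)%:R * Y i w.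
  rewrite -natr1 exprD1n; apply: eq_bigr => i _.
  by rewrite /Y mulr_natl.
suff H q : forall i, (i <= q)%N -> P.-integrable setT (EFin \o Y i).
  split; first exact: (H p).
  have [i1 e1] := @Rintegral_lincomb p.+1 (fun i => 'C(p, i)%:R) Y (fun i ip => H p i ip).
  rewrite -e1; have := @poisson_stein (fun k => k%:R ^+ p) _ _.
  case; first by move=> k; rewrite exprn_ge0.
    by apply: eq_integrable i1 => // w _ /=; rewrite SE.
  move=> _ H2; transitivity (m * \int[P]_w ((K w).+1%:R ^+ p)).
    by rewrite -H2; apply: eq_Rintegral => w _; exact: exprS.
  by congr (_ * _); apply: eq_Rintegral => w _; exact: SE.
elim: q => [|q IH] i; rewrite leq_eqVlt => /orP[/eqP ->|]; rewrite ?ltnS //.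
- have := finite_measure_integrable_cst P 1 measurableT.
  by apply: eq_integrable => // w _ /=; rewrite /Y expr0.
- have [i1 _] := @Rintegral_lincomb q.+1 (fun i => 'C(q, i)%:R) Y (fun i ip => IH i ip).
  have := @poisson_stein (fun k => k%:R ^+ q) _ _.
  case; first by move=> k; rewrite exprn_ge0.
    by apply: eq_integrable i1 => // w _ /=; rewrite SE.
  by move=> i2 _; apply: eq_integrable i2 => // w _ /=; rewrite /Y exprS.
- exact: IH.
Qed.

(* [(K - m)^2 - K] is the second Charlier polynomial of [K], orthogonal to [K - m]. *)
Definition charlier (b D : R) (k : nat) : R :=
  b * (k%:R - m) + D * ((k%:R - m) ^+ 2 - k%:R).

Lemma charlier_moments b D :
  [/\ P.-integrable setT (fun w => (charlier b D (K w))%:E),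
     P.-integrable setT (fun w => (charlier b D (K w) ^+ 2)%:E),
     \int[P]_w charlier b D (K w) = 0 &
     \int[P]_w (charlier b D (K w) ^+ 2) = b ^+ 2 * m + 2 * D ^+ 2 * m ^+ 2].
Proof.
pose Y i w : R := (K w)%:R ^+ i.
have I0 : \int[P]_w Y 0 w = 1.
  rewrite /Y; under eq_Rintegral do rewrite expr0.
  by rewrite Rintegral_cst //= probability_setT mulr1.
have [_ I1] := poisson_moments 0; have [_ I2] := poisson_moments 1.
have [_ I3] := poisson_moments 2; have [_ I4] := poisson_moments 3.
move: I1 I2 I3 I4; rewrite !big_ord_recr !big_ord0 /= ![\int[P]_w _ ^+ 0]I0.
rewrite !bin0 !binn !bin1 (_ : 'C(3, 2) = 3%N) // => I1 I2 I3 I4.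
(* [charlier b D k = D k^2 + B k + C]; the lists below hold the coefficients of this polynomial and
   of its square. *)
pose B := b - 2 * D * m - D; pose C := D * m ^+ 2 - b * m.
have [a1 a2] := @Rintegral_lincomb 3 (fun i => nth 0 [:: C; B; D] i) Y
  (fun i _ => (poisson_moments i).1).
have [c1 c2] := @Rintegral_lincomb 5
  (fun i => nth 0 [:: C ^+ 2; 2 * B * C; B ^+ 2 + 2 * D * C; 2 * D * B; D ^+ 2] i) Y
  (fun i _ => (poisson_moments i).1).
have E1 w : \sum_(p < 3) [:: C; B; D]`_p * Y p w = charlier b D (K w).
  by rewrite !big_ord_recr big_ord0 /= /Y /charlier /B /C; ring.
have E2 w : \sum_(p < 5) [:: C ^+ 2; 2 * B * C; B ^+ 2 + 2 * D * C; 2 * D * B; D ^+ 2]`_p * Y p w =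
   charlier b D (K w) ^+ 2.
  by rewrite !big_ord_recr big_ord0 /= /Y /charlier /B /C; ring.
split.
- by apply: eq_integrable a1 => // w _; rewrite E1.
- by apply: eq_integrable c1 => // w _; rewrite E2.
- under eq_Rintegral do rewrite -E1.
  rewrite a2 !big_ord_recr big_ord0 /= I0 I1 I2 I1 /B /C; ring.
- under eq_Rintegral do rewrite -E2.
  rewrite c2 !big_ord_recr big_ord0 /= I0 I4 I3 I2 I1 /B /C; ring.
Qed.

End poisson_moments.

Section independent_poisson_counts.
Context {R : realType} {d : measure_display} {Omega : measurableType d}.
Variable P : probability Omega R.

(** The summands are centered and pairwise independent, so the cross terms vanish and the variances
    add up. *)
Lemma charlier_sum_sqr n (K : 'I_n -> Omega -> nat) (m b : 'I_n -> R) (D : R) :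
  (forall c, measurable_fun setT (K c)) -> (forall c, 0 <= m c) ->
  (forall c, poisson_count P (K c) (m c)) ->
  (forall c c', c != c' -> forall i j, P (K c @^-1` [set i] `&` K c' @^-1` [set j]) =
     (P (K c @^-1` [set i]) * P (K c' @^-1` [set j]))%E) ->
  (\int[P]_w ((\sum_c charlier (m c) (b c) D (K c w)) ^+ 2)%:E =
   (\sum_c (b c ^+ 2 * m c + 2 * D ^+ 2 * m c ^+ 2))%:E)%E.
Proof.
move=> mK m0 Km ind.
pose f c w := charlier (m c) (b c) D (K c w).
have fP c := charlier_moments (mK c) (m0 c) (Km c) (b c) D.
have ff c c' : P.-integrable setT (fun w => (f c w * f c' w)%:E) /\
    \int[P]_w (f c w * f c' w) =
    if c == c' then b c ^+ 2 * m c + 2 * D ^+ 2 * m c ^+ 2 else 0.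
  have [<-|cc'] := eqVneq c c'; first by have [_ i _ e] := fP c.
  have [i _ e _] := fP c; have [i' _ e' _] := fP c'.
  have [] := Rintegral_indep (mK c) (mK c') (ind _ _ cc') i i'.
  by rewrite e mul0r.
have E w : (\sum_c charlier (m c) (b c) D (K c w)) ^+ 2 = \sum_c \sum_c' f c w * f c' w.
  by rewrite expr2 big_distrl /=; apply: eq_bigr => c _; rewrite big_distrr.
have Ii c : P.-integrable setT (fun w => (\sum_c' f c w * f c' w)%:E).
  have := @integrable_sum _ _ _ P setT measurableT _ (index_enum 'I_n) xpredT _
    (fun c' _ => (ff c c').1).
  by apply: eq_integrable => // w _ /=; rewrite sumEFin.
have Iii : P.-integrable setT (fun w => (\sum_c \sum_c' f c w * f c' w)%:E).
  have := @integrable_sum _ _ _ P setT measurableT _ (index_enum 'I_n) xpredT _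
    (fun c _ => Ii c).
  by apply: eq_integrable => // w _ /=; rewrite sumEFin.
transitivity (\int[P]_w (\sum_c \sum_c' f c w * f c' w)%:E)%E.
  by apply: eq_integral => w _; rewrite E.
rewrite -[LHS]fineK; last exact: integrable_fin_num.
congr EFin; rewrite -[LHS]/(\int[P]_w (\sum_c \sum_c' f c w * f c' w)) Rintegral_sum //.
apply: eq_bigr => c _; rewrite Rintegral_sum //; last by move=> c'; exact: (ff c c').1.
rewrite (bigD1 c) //= (ff c c).2 eqxx big1 ?addr0 // => c' cc'.
by rewrite (ff c c').2 eq_sym (negbTE cc').
Qed.

End independent_poisson_counts.

(** * The law under the null hypothesis *)

Section throw_law.
Context {R : realType} {T : finType}.
Implicit Types (v w : {ffun T -> nat}) (c : T).
Hypothesis T_gt0 : (0 < #|T|)%N.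

Let D : R := #|T|%:R.

(** The multinomial law, by induction through the last ball: if it falls in [c], the vector before
    it was [v] with one ball less in [c], whose weight carries a factor [v c], and these factors add
    up to [n + 1]. *)
Lemma throw_delta n v :
  throw n (fun w => (w == v)%:R) [ffun=> 0%N] =
  (total v == n)%:R * n`!%:R / (D ^+ n * \prod_c (v c)`!%:R).
Proof.
have D0 : D != 0 by rewrite pnatr_eq0 -lt0n.
have p0 v' : \prod_c (v' c)`!%:R != 0 :> R.
  by apply/prodf_neq0 => c _; rewrite pnatr_eq0 -lt0n fact_gt0.
elim: n v => [|n IH] v.
  rewrite /= expr0 mul1r fact0 mulr1 /total sum_nat_eq0.
  case: eqP => [<-|v0].
    rewrite (introT forallP); last by move=> c; rewrite ffunE.
    by rewrite big1 ?divr1 // => c _; rewrite ffunE fact0.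
  case: forallP => [H|_]; last by rewrite mul0r.
  by case: v0; apply/ffunP => c; rewrite ffunE (eqP (H c)).
rewrite throwSr throwZ throw_sum.
have step c : throw n (fun w => (addball w c == v)%:R) [ffun=> 0%N] =
   (total v == n.+1)%:R * n`!%:R / (D ^+ n * \prod_c (v c)`!%:R) * (v c)%:R.
  case E : (v c) => [|k].
    rewrite mulr0 (_ : (fun w => _) = (fun=> 0)) ?throw_cst //.
    apply/funext => w; case: eqP => // wv; move: E.
    by rewrite -wv ffunE eqxx addn1.
  pose v' : {ffun T -> nat} := [ffun x => (v x - (x == c))%N].
  have vE : v = addball v' c.
    apply/ffunP => x; rewrite !ffunE; case: eqP => [->|_]; last by rewrite subn0 addn0.
    by rewrite subnK // E.
  have -> : (fun w => (addball w c == v)%:R) = (fun w => (w == v')%:R) :> ({ffun T -> nat} -> R).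
    apply/funext => w; congr (_%:R); rewrite {1}vE; congr nat_of_bool.
    apply/eqP/eqP => [/ffunP H|->] //; apply/ffunP => x.
    by move: (H x); rewrite ![addball _ _ _]ffunE => /addIn.
  rewrite IH vE total_addball eqSS.
  have -> : \prod_x (addball v' c x)`!%:R = k.+1%:R * \prod_c (v' c)`!%:R :> R.
    have v'c : v' c = k by rewrite ffunE eqxx E subn1.
    rewrite (bigD1 c) //= [in RHS](bigD1 c) //= mulrA; congr (_ * _).
      by rewrite ffunE eqxx addn1 v'c factS natrM.
    by apply: eq_bigr => x /negbTE xc; rewrite ffunE xc addn0.
  have k0 : k.+1%:R != 0 :> R by rewrite pnatr_eq0.
  by field; rewrite p0 addrC natr1 k0 expf_neq0.
rewrite (eq_bigr _ (fun c _ => step c)) -mulr_sumr -natr_sum -/(total v).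
case: eqP => [->|_]; last by rewrite !mul0r mulr0.
rewrite factS natrM exprS; field.
by rewrite p0 expf_neq0.
Qed.

(** A vector of total [n] has entries at most [n], so [{ffun T -> 'I_n.+1}] enumerates all the
    outcomes of [n] throws and expectations become finite sums. *)
Definition occ_val n (u : {ffun T -> 'I_n}) : {ffun T -> nat} := [ffun c => nat_of_ord (u c)].

Lemma occ_val_inj n : injective (@occ_val n).
Proof.
move=> u u' /ffunP E; apply/ffunP => c; apply: val_inj.
by have := E c; rewrite !ffunE.
Qed.

Lemma occ_val_total n v : total v = n -> exists u : {ffun T -> 'I_n.+1}, occ_val u = v.
Proof.
move=> tv; exists [ffun c => inord (v c)]; apply/ffunP => c; rewrite !ffunE inordK //.
by rewrite ltnS -tv /total (bigD1 c) //= leq_addr.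
Qed.

Lemma throw_expand n (F : {ffun T -> nat} -> R) :
  throw n F [ffun=> 0%N] = \sum_(u : {ffun T -> 'I_n.+1})
    F (occ_val u) * throw n (fun w => (w == occ_val u)%:R) [ffun=> 0%N].
Proof.
rewrite -(eq_bigr _ (fun u _ => throwZ n (F (occ_val u)) _ _)) -throw_sum.
apply: eq_throw_ge => w tw _.
have t0 : total ([ffun=> 0%N] : {ffun T -> nat}) = 0%N.
  by rewrite /total big1 // => c _; rewrite ffunE.
have [u uw] : exists u : {ffun T -> 'I_n.+1}, occ_val u = w.
  by apply: occ_val_total; rewrite tw t0.
rewrite (bigD1 u) //= uw eqxx mulr1 big1 ?addr0 // => u' u'u.
case: eqP => [wu|_]; last by rewrite mulr0.
by move: u'u; rewrite (occ_val_inj (etrans uw wu)) eqxx.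
Qed.

End throw_law.

Lemma measure_in_seq {R : realType} {d : measure_display} {Omega : measurableType d}
  (P : {measure set Omega -> \bar R}) {U : eqType} (f : Omega -> U) (r : seq U) (A : set Omega) :
  uniq r -> (forall u, measurable (A `&` [set w | f w = u])) ->
  (P (A `&` [set w | f w \in r]) = \sum_(u <- r) P (A `&` [set w | f w = u]))%E.
Proof.
move=> + mA; elim: r => [|u r IH] /=.
  move=> _; rewrite big_nil (_ : _ `&` _ = set0) ?measure0 //.
  by apply/seteqP; split => w // [].
case/andP => ur /IH {}IH; rewrite big_cons -IH -measureU //; last 2 first.
- have -> : A `&` [set w | f w \in r] = \bigcup_(u in [set` r]) (A `&` [set w | f w = u]).
    apply/seteqP; split => w; first by move=> [Aw fw]; exists (f w).
    by move=> [v vr [Aw /= fv]]; split => //=; rewrite fv.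
  exact: fin_bigcup_measurable.
- apply/seteqP; split => w // [[_ /= fu] [_ /= fr]].
  by move: ur; rewrite -fu fr.
congr (P _); apply/seteqP; split => w /=.
  by move=> [Aw]; rewrite in_cons => /orP[/eqP fu|fr]; [left|right].
by move=> [[Aw fu]|[Aw fr]]; split => //; rewrite in_cons ?fu ?eqxx ?fr ?orbT.
Qed.

Section experiment_law.
Context {R : realType} {d : measure_display} {Omega : measurableType d}.
Variables (N : Omega -> nat) (X : nat -> Omega -> R) (L : R).
Variable P : (R -> R) -> probability Omega R.
Hypothesis L0 : 0 < L.
Hypothesis NXP : poisson_experiment N X L P.

Local Notation cnt := (count_in N X).
Local Notation occ := (occupancy N X).

Lemma measurable_points : measurable_fun setT N. Proof. by case: NXP. Qed.

Lemma measurable_count_in (A : set R) : measurable A -> measurable_fun setT (cnt A).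
Proof.
have [mN mX _ _] := NXP => mA.
(* The number of summands in [count_in] is random: [g n] counts among the first [n] points, and the
   event is cut along the values of [N]. *)
pose g n w := (\sum_(l < n) (X l w \in A))%N.
have mg n (B : set nat) : measurable (g n @^-1` B).
  elim: n B => [|n IH] B.
    have [B0|B0] := pselect (B 0%N).
      rewrite (_ : _ @^-1` _ = setT) //; apply/seteqP; split => w // _.
      by rewrite /g /= big_ord0.
    rewrite (_ : _ @^-1` _ = set0) //; apply/seteqP; split => w //.
    by rewrite /g /= big_ord0.
  have mXA : measurable (X n @^-1` A) by rewrite -[X in measurable X]setTI; exact: mX.
  have -> : g n.+1 @^-1` B = (X n @^-1` A `&` g n @^-1` [set k | B k.+1]) `|`
      (~` (X n @^-1` A) `&` g n @^-1` B).
    apply/seteqP; split => w /=; rewrite /g /= big_ord_recr /=.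
      case: (boolP (X n w \in A)) => [/set_mem XA|XA] /=; rewrite ?addn0 ?addn1 => Bw.
        by left.
      by right; split => // XA'; move: XA; rewrite mem_set.
    case => -[XA Bw]; first by rewrite mem_set // addn1.
    by rewrite memNset // addn0.
  apply: measurableU; apply: measurableI => //; exact: measurableC.
move=> _ B _; rewrite setTI.
have -> : cnt A @^-1` B = \bigcup_n (N @^-1` [set n] `&` g n @^-1` B).
  by apply/seteqP; split => w; [move=> Bw; exists (N w)|move=> [n _ [/= <-]]].
apply: bigcup_measurable => n _; apply: measurableI => //.
by apply: measurable_preimage_nat.
Qed.

Section intensity.
Variable s : R -> R.
Hypothesis is_s : intensities s.

Lemma poisson_count_in (A : set R) : measurable A ->
  poisson_count (P s) (cnt A) (L * mass s A).
Proof. by move=> mA B; case: NXP => _ _ _ /(_ s is_s)[/(_ A mA B) -> _]. Qed.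

Lemma intensity_mass_ge0 (A : set R) : 0 <= mass s A.
Proof.
by apply: Rintegral_ge0 => x [_ /=]; rewrite in_itv /=; case: is_s => _; apply.
Qed.

Lemma count_in_indep (A B : set R) i j : measurable A -> measurable B -> A `&` B = set0 ->
  (P s (cnt A @^-1` [set i] `&` cnt B @^-1` [set j]) =
   P s (cnt A @^-1` [set i]) * P s (cnt B @^-1` [set j]))%E.
Proof.
move=> mA mB AB; case: NXP => _ _ _ /(_ s is_s)[_].
have mF (k : 'I_2) : measurable (if k == ord0 then A else B) by case: ifP.
have tF : trivIset setT (fun k : 'I_2 => if k == ord0 then A else B).
  move=> k l _ _; case: (eqVneq k ord0) => k0; case: (eqVneq l ord0) => l0.
  - by rewrite k0 l0.
  - by move=> /set0P; rewrite AB eqxx.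
  - by move=> /set0P; rewrite setIC AB eqxx.
  - move=> _; apply: val_inj; case: k l k0 l0 => [[|[|k]] //= _] [[|[|l]] //= _] //.
move=> /(_ 2%N _ mF tF (fun k => if k == ord0 then [set i] else [set j])).
rewrite !big_ord_recl big_ord0 /= mule1 => <-; congr (P s _).
apply/seteqP; split => w.
  by move=> [Ai Bj] k _; case: (eqVneq k ord0).
move=> H; split; first exact: (H ord0).
exact: (H (lift ord0 ord0)).
Qed.

Lemma cell_disjoint J c c' : c != c' -> cell J c `&` cell J c' = set0 :> set R.
Proof.
move=> cc'; apply/seteqP; split => x // [/mem_set + /mem_set].
rewrite !in_cell => /andP[h1 h2] /andP[h3 h4].
have := le_lt_trans h1 h4; have := le_lt_trans h3 h2; rewrite !ltr_nat !ltnS => l1 l2.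
by move: cc'; rewrite eqn_leq l1 l2.
Qed.

Lemma occupancy_atom J (v : {ffun 'I_(2 ^ J) -> nat}) :
  P s [set w | occ J w = v] =
  (\prod_(c < 2 ^ J) P s (cnt (cell J c) @^-1` [set v c]))%E.
Proof.
case: NXP => _ _ _ /(_ s is_s)[_].
have tF : trivIset setT (fun c : 'I_(2 ^ J) => cell J c : set R).
  move=> c c' _ _ [x cx]; apply: val_inj; apply/eqP/negPn/negP => cc'.
  by have /seteqP[/(_ x cx)] := cell_disjoint J cc'.
move=> /(_ (2 ^ J)%N _ (fun c => measurable_cell J c) tF (fun c => [set v c])) <-.
congr (P s _); apply/seteqP; split => w.
  by move=> /= <- c _ /=; rewrite ffunE.
by move=> H; apply/ffunP => c; rewrite ffunE; exact: (H c I).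
Qed.

Lemma measurable_occupancy_atom J (v : {ffun 'I_(2 ^ J) -> nat}) :
  measurable [set w | occ J w = v].
Proof.
have -> : [set w | occ J w = v] = \bigcap_(c in [set: 'I_(2 ^ J)]) (cnt (cell J c) @^-1` [set v c]).
  apply/seteqP; split => w; first by move=> /= <- c _ /=; rewrite ffunE.
  by move=> H; apply/ffunP => c; rewrite ffunE; exact: (H c I).
apply: fin_bigcap_measurable => // c _.
by apply: measurable_preimage_nat; exact: (measurable_count_in (measurable_cell J c)).
Qed.

Lemma measurable_occupancy J (Q : pred {ffun 'I_(2 ^ J) -> nat}) :
  measurable [set w | Q (occ J w)].
Proof.
have -> : [set w | Q (occ J w)] = \bigcup_n
    \bigcup_(u in [set u : {ffun 'I_(2 ^ J) -> 'I_n.+1} | Q (occ_val u)])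
    [set w | occ J w = occ_val u].
  apply/seteqP; split => w; last by move=> [n _ [u /= Qu ->]].
  move=> /= Qw; exists (total (occ J w)) => //.
  by have [u uw] := @occ_val_total _ _ (occ J w) erefl; exists u; rewrite /= uw.
apply: bigcup_measurable => n _; apply: fin_bigcup_measurable => // u _.
exact: measurable_occupancy_atom.
Qed.

(** [N] and [total] differ only by the points equal to 1, whose number is Poisson with mean 0. *)
Lemma points_total J n (A : set Omega) : measurable A ->
  P s (A `&` [set w | N w = n]) = P s (A `&` [set w | total (occ J w) = n]).
Proof.
have [mN mX X01 _] := NXP => mA.
pose Z := cnt [set 1] @^-1` [set k | k != 0%N].
have m1 := measurable_count_in (measurable_set1 1).
have mZ : measurable Z by exact: measurable_preimage_nat.
have Z0 : P s Z = 0%E.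
  rewrite (poisson_count_in (measurable_set1 1)) /mass.
  have -> : [set 1] `&` `[0, 1]%classic = [set 1] :> set R.
    by apply/seteqP; split => x /=; [by case|move=> ->]; split => //=; rewrite in_itv /= ler01 lexx.
  by rewrite Rintegral_set1 mulr0 /poisson_prob ltxx diracE memNset.
have mt : measurable [set w | total (occ J w) = n].
  have -> : [set w | total (occ J w) = n] = [set w | total (occ J w) == n].
    by apply/seteqP; split => w /= /eqP.
  exact: (measurable_occupancy (fun v => total v == n)).
have mn : measurable [set w | N w = n].
  exact: (measurable_preimage_nat [set n] mN).
have NZ w : ~ Z w -> N w = total (occ J w).
  move=> /negP/negPn/eqP c1; rewrite total_occupancy -[RHS]addn0 -[X in _ = (_ + X)%N]c1.
  rewrite /count_in -big_split /= -[LHS]card_ord -sum1_card; apply: eq_bigr => l _.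
  have /andP[x0 x1] := X01 w l (ltn_ord l).
  rewrite cell00; move: x1; rewrite le_eqVlt => /orP[/eqP ->|x1].
    by rewrite memNset ?mem_set //= in_itv /= ltxx andbF.
  rewrite mem_set /= ?in_itv /= ?x0 // memNset // => /eqP.
  by rewrite lt_eqF.
apply/le_anti/andP; split.
  rewrite -[leRHS]adde0 -Z0; apply: le_trans (measureU2 _ _ _) => //; last exact: measurableI.
  apply: le_measure; rewrite ?inE.
  - exact: measurableI.
  - by apply: measurableU => //; exact: measurableI.
  move=> w [Aw Nw]; have [Zw|Zw] := pselect (Z w); [by right|left; split => //=].
  by rewrite -NZ.
rewrite -[leRHS]adde0 -Z0; apply: le_trans (measureU2 _ _ _) => //; last exact: measurableI.
apply: le_measure; rewrite ?inE; [exact: measurableI|apply: measurableU => //; exact: measurableI|].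
move=> w [Aw Nw]; have [Zw|Zw] := pselect (Z w); [by right|left; split => //=].
by rewrite NZ.
Qed.

(** Independent Poisson counts of equal means, given their total, are multinomial, whatever the
    common mean. The product form avoids dividing by [P s [set w | N w = n]], which may be 0 when
    [c0 = 0]. *)
Lemma constant_intensity_law c0 J n (Q : pred {ffun 'I_(2 ^ J) -> nat}) :
  (forall x : R, 0 <= x <= 1 -> s x = c0) ->
  P s ([set w | Q (occ J w)] `&` [set w | N w = n]) =
  (P s [set w | N w = n] * (throw n (fun v => (Q v)%:R) [ffun=> 0%N])%:E)%E.
Proof.
move=> sc.
have D0 : (0 < #|'I_(2 ^ J)|)%N by rewrite card_ord expn_gt0.
have c00 : 0 <= c0.
  by case: is_s => _ /(_ 0); rewrite sc lexx ler01 //; apply.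
rewrite (points_total J) //; last exact: measurable_occupancy.
pose r := [seq occ_val u | u <- index_enum {ffun 'I_(2 ^ J) -> 'I_n.+1}
  & Q (occ_val u) && (total (occ_val u) == n)].
have ur : uniq r.
  by rewrite map_inj_uniq ?filter_uniq ?index_enum_uniq //; exact: occ_val_inj.
have -> : [set w | Q (occ J w)] `&` [set w | total (occ J w) = n] =
   setT `&` [set w | occ J w \in r].
  rewrite setTI; apply/seteqP; split => w /=.
    move=> [Qw tw]; have [u uw] := occ_val_total tw.
    by apply/mapP; exists u; rewrite // mem_filter mem_index_enum uw Qw tw eqxx.
  by move=> /mapP[u]; rewrite mem_filter => /andP[/andP[Qu /eqP tu] _] ->.
rewrite (measure_in_seq (P s) ur); last first.
  by move=> u; rewrite setTI; exact: measurable_occupancy_atom.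
rewrite big_map big_filter /=.
set D : R := 2 ^+ J; have Dn0 : D != 0 by rewrite expf_neq0.
pose m := L * c0 / D.
have mass_cell (c : 'I_(2 ^ J)) : L * mass s (cell J c) = m.
  have i : (@lebesgue_measure R).-integrable `[0, 1] (EFin \o (\1_(cell J c) : R -> R)).
    apply: (@bounded_integrable01 _ _ 1); first exact: (measurable_indic (measurable_cell J c)).
    by move=> x _; rewrite indicE; case: (_ \in _); rewrite ?normr1 ?normr0.
  rewrite massE.
  transitivity (L * \int[@lebesgue_measure R]_(x in `[0, 1]) (c0 * \1_(cell J c) x)).
    congr (_ * _); apply: eq_Rintegral.
    by move=> x /set_mem /=; rewrite in_itv /= => x01; rewrite sc.
  by rewrite (RintegralZl _ _ i) // Rintegral_cell // mulrA.
have massT : L * mass s setT = D * m.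
  rewrite massE.
  transitivity (L * \int[@lebesgue_measure R]_(x in `[0, 1]) (fun=> c0) x).
    congr (_ * _); apply: eq_Rintegral.
    by move=> x /set_mem /=; rewrite in_itv /= => x01; rewrite sc // indicT mulr1.
  by rewrite Rintegral01_cst /m; field.
have -> : [set w | N w = n] = cnt setT @^-1` [set n].
  have NT w : cnt setT w = N w.
    rewrite /count_in; under eq_bigr do rewrite in_setT.
    by rewrite sum_nat_const muln1 card_ord.
  by apply/seteqP; split => w /=; rewrite NT.
rewrite (poisson_count1 _ (poisson_count_in measurableT)); last first.
  by apply: mulr_ge0; [exact: ltW|exact: intensity_mass_ge0].
rewrite massT -EFinM throw_expand.
have atom (v : {ffun 'I_(2 ^ J) -> nat}) : P s (setT `&` [set w | occ J w = v]) =
   (m ^+ total v * (\prod_c (v c)`!%:R)^-1 * expR (- (D * m)))%:E.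
  rewrite setTI occupancy_atom.
  rewrite (eq_bigr (fun c => (m ^+ v c * (v c)`!%:R^-1 * expR (- m))%:E)); last first.
    move=> c _; rewrite (poisson_count1 _ (poisson_count_in (measurable_cell J c))).
      by rewrite mass_cell.
    by apply: mulr_ge0; [exact: ltW|exact: intensity_mass_ge0].
  rewrite -(big_morph EFin (@EFinM R) erefl) !big_split /= prodfV -expr_sum.
  rewrite prodr_const card_ord; congr (_ * _)%:E.
  have -> : - (D * m) = (2 ^ J)%:R * (- m) by rewrite natrX mulrN.
  by rewrite expRM_natl.
rewrite (eq_bigr _ (fun u _ => atom _)) sumEFin; congr EFin.
rewrite mulr_sumr big_mkcond; apply: eq_bigr => u _ /=.
rewrite throw_delta // card_ord natrX -/D.
case: (Q _) => /=; last by rewrite !mul0r mulr0.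
case: eqP => [->|_]; last by rewrite !mul0r mulr0 mulr0.
have p0 : \prod_c (occ_val u c)`!%:R != 0 :> R.
  by apply/prodf_neq0 => c _; rewrite pnatr_eq0 -lt0n fact_gt0.
have f0 : n`!%:R != 0 :> R by rewrite pnatr_eq0 -lt0n fact_gt0.
rewrite [(D * m) ^+ n]exprMn (_ : true%:R = 1) //; set p := \prod_c _ in p0 *.
clearbody m; by field; rewrite p0 f0 expf_neq0.
Qed.

End intensity.
End experiment_law.

(** * Quantiles and calibrated levels of the test *)

Section null_hypothesis.
Context {R : realType} {d : measure_display} {Omega : measurableType d}.
Variables (N : Omega -> nat) (X : nat -> Omega -> R) (L : R).
Variable P : (R -> R) -> probability Omega R.
Hypothesis L0 : 0 < L.
Hypothesis NXP : poisson_experiment N X L P.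

Local Notation occ := (occupancy N X).
Local Notation T J v := ((L ^+ 2)^-1 * collisions (v : {ffun 'I_(2 ^ J) -> nat})).
Local Notation nothing := [ffun=> 0%N].

Lemma card_cells J : (0 < #|'I_(2 ^ J)|)%N.
Proof. by rewrite card_ord expn_gt0. Qed.

Lemma measurable_points_eq n : measurable [set w | N w = n].
Proof. exact: (measurable_preimage_nat [set n] (measurable_points NXP)). Qed.

Lemma measurable_stat_le J (t : R) : measurable [set w | stat N X L J w <= t].
Proof.
have -> : [set w | stat N X L J w <= t] = [set w | T J (occ J w) <= t].
  by apply/seteqP; split => w /=; rewrite statE.
exact: (measurable_occupancy NXP (fun v => T J v <= t)).
Qed.

Lemma intensities_cst (c : R) : 0 <= c -> intensities (cst c).
Proof.
move=> c0; split => //; split => //.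
exact: (@bounded_integrable01 _ (fun=> c ^+ 2) `|c ^+ 2|).
Qed.

Lemma cond_prob_occupancy s c0 J n (Q : pred {ffun 'I_(2 ^ J) -> nat}) :
  intensities s -> (forall x : R, 0 <= x <= 1 -> s x = c0) ->
  P s [set w | N w = n] != 0%E ->
  cond_prob N P s n [set w | Q (occ J w)] = throw n (fun v => (Q v)%:R) nothing.
Proof.
move=> is_s sc Pn; rewrite /cond_prob (constant_intensity_law L0 NXP is_s _ _ sc).
have fN : P s [set w | N w = n] \is a fin_num.
  by apply: fin_num_measure; exact: measurable_points_eq.
rewrite fineM //= mulrAC mulfV ?mul1r // fine_eq0 //.
Qed.

Lemma null_reference n : P (cst 1) [set w | N w = n] != 0%E.
Proof.
have c1 : intensities (cst 1 : R -> R) by exact: intensities_cst.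
have -> : [set w | N w = n] = count_in N X setT @^-1` [set n].
  have NT w : count_in N X setT w = N w.
    rewrite /count_in; under eq_bigr do rewrite in_setT.
    by rewrite sum_nat_const muln1 card_ord.
  by apply/seteqP; split => w /=; rewrite NT.
have m1 : mass (cst 1 : R -> R) setT = 1 by rewrite /mass setTI Rintegral01_cst.
rewrite (poisson_count1 _ (poisson_count_in NXP c1 measurableT)) m1 mulr1; last exact: ltW.
rewrite eqe gt_eqF // !mulr_gt0 ?expR_gt0 ?exprn_gt0 // invr_gt0 ltr0n fact_gt0 //.
Qed.

Definition null_cdf J n (t : R) : R := throw n (fun v => (T J v <= t)%R%:R) nothing.

Lemma cond_prob_stat_le s c0 J n t :
  intensities s -> (forall x : R, 0 <= x <= 1 -> s x = c0) ->
  P s [set w | N w = n] != 0%E ->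
  cond_prob N P s n [set w | stat N X L J w <= t] = null_cdf J n t.
Proof.
move=> is_s sc Pn; rewrite /null_cdf -(cond_prob_occupancy (fun v => T J v <= t) is_s sc Pn).
by congr cond_prob; apply/seteqP; split => w /=; rewrite statE.
Qed.

Lemma null_quantileE J n u :
  null_quantile N X L P J n u = inf [set t | 1 - u <= null_cdf J n t].
Proof.
rewrite /null_quantile; congr inf; apply/seteqP; split => t /=;
by rewrite (@cond_prob_stat_le _ 1) //; [exact: intensities_cst|exact: null_reference].
Qed.

Lemma null_cdf_gt J n t : throw n (fun v => (t < T J v)%R%:R) nothing = 1 - null_cdf J n t.
Proof.
apply/eqP; rewrite eq_sym subr_eq -throwD; apply/eqP.
rewrite -[LHS](throw_cst (card_cells J) n 1 nothing); congr (throw n _ _).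
by apply/funext => v; case: ltP => _ /=; rewrite ?addr0 ?add0r.
Qed.

Lemma collisions_ge n (v : {ffun 'I_n -> nat}) : - (total v)%:R ^+ 2 <= collisions v :> R.
Proof.
rewrite /collisions; have : 0 <= \sum_c ((v c)%:R ^+ 2 - (v c)%:R) :> R.
  apply: sumr_ge0 => c _; case: (v c) => [|k]; first by rewrite expr0n subrr.
  by rewrite -natr1; have : 0 <= k%:R :> R by []; nra.
have : 0 <= (total v)%:R :> R by [].
have : 0 <= #|'I_n|%:R :> R by [].
by nra.
Qed.

(** Makes [inf] a genuine infimum: below every attainable value the distribution function is 0,
    hence less than [1 - u]. *)
Lemma null_quantile_lbound J n u : u < 1 -> has_lbound [set t | 1 - u <= null_cdf J n t].
Proof.
move=> u1; exists (- ((L ^+ 2)^-1 * n%:R ^+ 2)) => t /= ut; rewrite leNgt; apply/negP => tn.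
move: ut; rewrite leNgt => /negP; apply.
rewrite [X in X < _](_ : _ = 0) ?subr_gt0 //.
rewrite /null_cdf (@eq_throw_ge _ _ _ _ (fun=> 0)) ?throw_cst ?card_cells // => w tw _.
have t0 : total (nothing : {ffun 'I_(2 ^ J) -> nat}) = 0%N.
  by rewrite /total big1 // => c _; rewrite ffunE.
have := collisions_ge w; rewrite tw t0 add0n => wn.
rewrite leNgt (lt_le_trans tn) // -mulrN ler_wpM2l // invr_ge0 exprn_ge0 //.
exact: ltW.
Qed.

(** Accounts for the right continuity of [null_cdf]: a statistic with finitely many values takes
    none in []q, q + e]]. *)
Lemma gap_above (r : seq R) q : exists2 e : R, 0 < e & {in r, forall x, q < x -> q + e < x}.
Proof.
elim: r => [|x r [e e0 er]]; first by exists 1.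
have [qx|xq] := ltP q x; last first.
  exists e => // y; rewrite inE => /orP[/eqP ->|]; last exact: er.
  by move=> /(le_lt_trans xq); rewrite ltxx.
exists (Num.min e ((x - q) / 2)); first by rewrite lt_min e0; lra.
have m1 : Num.min e ((x - q) / 2) <= e by rewrite ge_min lexx.
have m2 : Num.min e ((x - q) / 2) <= (x - q) / 2 by rewrite ge_min lexx orbT.
move=> y; rewrite inE => /orP[/eqP -> _|yr qy]; first by lra.
by have := er y yr qy; lra.
Qed.

Lemma null_tail_quantile J n u : 0 < u < 1 ->
  throw n (fun v => (null_quantile N X L P J n u < T J v)%R%:R) nothing <= u.
Proof.
move=> /andP[u0 u1]; rewrite null_cdf_gt lerBlDl -lerBlDr null_quantileE.
set S := [set t | _]; set q := inf S.
have Sne : S !=set0.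
  pose M := \big[Num.max/0]_(k : {ffun 'I_(2 ^ J) -> 'I_n.+1}) T J (occ_val k).
  exists M; rewrite /S /= (_ : null_cdf J n M = 1); first by lra.
  rewrite -[RHS](throw_cst (card_cells J) n 1 nothing) /null_cdf.
  rewrite (throw_expand n (fun v => (T J v <= M)%R%:R)) (throw_expand n (fun=> 1)).
  by apply: eq_bigr => k _; rewrite (le_bigmax_cond _ (fun k => T J (occ_val k))).
have Sinf : has_inf S by split => //; exact: null_quantile_lbound.
rewrite leNgt; apply/negP => qS.
have [e e0 eP] := gap_above [seq T J (occ_val k) | k : {ffun 'I_(2 ^ J) -> 'I_n.+1}] q.
have [t St tq] := inf_adherent e0 Sinf.
(* As [t < q + e], no value of the statistic lies in []q, t]], and passing from [q] to [t] gains no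
   mass. *)
have : null_cdf J n t <= null_cdf J n q.
  rewrite /null_cdf !(throw_expand n (fun v => (T J v <= _)%R%:R)).
  apply: ler_sum => k _; apply: ler_wpM2r.
    rewrite -[leLHS](throw_cst (card_cells J) n 0 nothing).
    by apply: throw_le.
  case: (leP (T J (occ_val k)) q) => [_|qk] /=; first by rewrite lern1 leq_b1.
  have := eP _ (map_f _ (mem_enum _ k)) qk => ek.
  have tk := lt_trans tq ek.
  by rewrite [X in nat_of_bool X]leNgt tk.
by move: St; rewrite /S /=; move: qS; lra.
Qed.

Lemma null_quantile_le J n u u' x : u <= u' -> u' < 1 ->
  throw n (fun v => (x < T J v)%R%:R) nothing <= u ->
  null_quantile N X L P J n u' <= x.
Proof.
move=> uu' u'1; rewrite null_cdf_gt => xu; rewrite null_quantileE.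
apply: ge_inf; first exact: null_quantile_lbound.
by rewrite /=; lra.
Qed.

Lemma sup_stat_gt0 (Js : seq nat) (thr : nat -> R) w :
  (0 < sup_stat N X L Js thr w)%E = has (fun J => thr J < stat N X L J w) Js.
Proof.
rewrite /sup_stat; elim: Js => [|J Js IH]; first by rewrite big_nil.
by rewrite big_cons lt_max IH lte_fin subr_gt0.
Qed.

Lemma measurable_sup_stat Js thr : measurable [set w | (0 < sup_stat N X L Js thr w)%E].
Proof.
under eq_set => w do rewrite sup_stat_gt0.
elim: Js => [|J Js IH]; first by rewrite (_ : [set w | _] = set0) //; apply/seteqP; split.
rewrite (_ : [set w | _] = ~` [set w | stat N X L J w <= thr J] `|`
  [set w | has (fun J => thr J < stat N X L J w) Js]); last first.
  apply/seteqP; split => w /=.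
    by move=> /orP[h|h]; [left; apply/negP; rewrite -ltNge|right].
  by move=> [/negP|->]; rewrite ?orbT // -ltNge => ->.
by apply: measurableU => //; apply: measurableC; exact: measurable_stat_le.
Qed.

Lemma null_sup_stat_le s c0 n (Js : seq nat) (thr : nat -> R) :
  intensities s -> (forall x : R, 0 <= x <= 1 -> s x = c0) ->
  P s [set w | N w = n] != 0%E ->
  cond_prob N P s n [set w | (0 < sup_stat N X L Js thr w)%E] <=
  \sum_(J <- Js) throw n (fun v => (thr J < T J v)%R%:R) nothing.
Proof.
move=> is_s sc Pn; have mn := measurable_points_eq n.
elim: Js => [|J Js IH].
  rewrite big_nil /cond_prob (_ : _ `&` _ = set0) ?measure0 ?mul0r //.
  by apply/seteqP; split => // w [/=]; rewrite sup_stat_gt0.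
rewrite big_cons; apply: le_trans (lerD (lexx _) IH).
rewrite -(cond_prob_occupancy (fun v => thr J < T J v) is_s sc Pn) /cond_prob -mulrDl.
have f (A : set Omega) : measurable A -> P s A \is a fin_num by exact: fin_num_measure.
have mJ : measurable [set w | thr J < T J (occ J w)].
  exact: (measurable_occupancy NXP (fun v => thr J < T J v)).
have mJs := measurable_sup_stat Js thr.
apply: ler_wpM2r; first by rewrite invr_ge0 fine_ge0.
rewrite -fineD ?f //; [|exact: measurableI..].
apply: fine_le; rewrite ?fin_numD ?f //.
- by apply: measurableI => //; exact: measurable_sup_stat.
- exact: measurableI.
- exact: measurableI.
apply: le_trans (measureU2 _ _ _); [|exact: measurableI..].
apply: le_measure; rewrite ?inE.
- by apply: measurableI => //; exact: measurable_sup_stat.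
- by apply: measurableU; exact: measurableI.
move=> w [/=]; rewrite sup_stat_gt0 /= statE => /orP[h|h] Nn; [left|right] => //.
by split => //=; rewrite sup_stat_gt0.
Qed.

Section weights.
Variables (Js : seq nat) (alpha : R).
Hypothesis size_Js : (1 < size Js)%N.
Hypothesis alpha01 : 0 < alpha < 1.

Let W : nat -> R := fun=> ln (size Js)%:R.

Let card_gt0 : 0 < (size Js)%:R :> R. Proof. by rewrite ltr0n ltnW. Qed.

Lemma expR_weight J : expR (- W J) = (size Js)%:R^-1.
Proof. by rewrite expRN lnK. Qed.

(** By the union bound over [Js], so that [u = alpha] belongs to the set whose supremum enters
    [level_coef]. *)
Lemma null_rejection_prob_le n : null_rejection_prob N X L P Js W n alpha <= alpha.
Proof.
rewrite /null_rejection_prob; apply: ge_sup.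
  exists (cond_prob N P (cst 1) n [set w | (0 < sup_stat N X L Js (fun J =>
    null_quantile N X L P J n (alpha * expR (- W J))) w)%E]).
  exists (cst 1) => //; split; first by exists 1.
  by split; [exact: intensities_cst|exact: null_reference].
move=> _ [s [[c0 sc] [is_s Pn]] <-].
apply: le_trans (null_sup_stat_le _ _ is_s sc Pn) _.
have aW : 0 < alpha / (size Js)%:R < 1.
  case/andP: alpha01 => a0 a1; rewrite divr_gt0 //= ltr_pdivrMr // mul1r.
  by apply: lt_trans a1 _; rewrite ltr1n.
apply: (@le_trans _ _ (\sum_(J <- Js) alpha / (size Js)%:R)).
  by apply: ler_sum => J _; rewrite expR_weight; exact: null_tail_quantile.
by rewrite big_const_seq count_predT iter_addr_0 -[X in X <= _]mulr_natr mulfVK // gt_eqF.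
Qed.

(** The calibrated level is at least the Bonferroni one. The strict bound by 1 comes from
    [1 < size Js] and keeps the quantile at this level a genuine infimum. *)
Lemma level_coef_ge J n : alpha / (size Js)%:R <= level_coef N X L P Js W alpha J n < 1.
Proof.
rewrite /level_coef expR_weight; set S := [set u | _].
have Sa : S alpha by split => //; exact: null_rejection_prob_le.
have uS : ubound S 1 by move=> u [/andP[_ /ltW]].
have aS : alpha <= sup S by apply: ub_le_sup => //; exists 1.
have S1 : sup S <= 1 by apply: ge_sup => //; exists alpha.
apply/andP; split; first by rewrite mulrC ler_wpM2l // invr_ge0 ltW.
by rewrite mulrC ltr_pdivrMr // mul1r (le_lt_trans S1) // ltr1n.
Qed.

(** Acceptance keeps [stat] below its calibrated quantile, which is below any [x] exceeded under the
    null with probability at most the Bonferroni level. The bound is uniform in [n <= n0] because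
    the threshold depends on the random [N w]. *)
Lemma test_eq0_stat_le J n0 x : J \in Js ->
  (forall n, (n <= n0)%N ->
     throw n (fun v => (x < T J v)%R%:R) nothing <= alpha / (size Js)%:R) ->
  forall w, test N X L P Js W alpha w = 0%N -> (N w <= n0)%N -> stat N X L J w <= x.
Proof.
move=> JJs tail w; rewrite /test /test_stat sup_stat_gt0; case: ifP => // /negbT/hasPn H _ Nn.
have := H J JJs; rewrite -leNgt => /le_trans; apply.
have /andP[h1 h2] := level_coef_ge J (N w).
exact: null_quantile_le h1 h2 (tail _ Nn).
Qed.

Lemma measurable_test_eq0 : measurable [set w | test N X L P Js W alpha w = 0%N].
Proof.
have -> : [set w | test N X L P Js W alpha w = 0%N] = \bigcup_n ([set w | N w = n] `&`
  ~` [set w | (0 < sup_stat N X L Js (fun J => null_quantile N X L P J n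
       (level_coef N X L P Js W alpha J n)) w)%E]).
  apply/seteqP; split => w /=.
    rewrite /test /test_stat => tw; exists (N w) => //; split => //.
    by move=> /= h; move: tw; rewrite h.
  by move=> [n _ [/= <- /negP/negbTE h]]; rewrite /test /test_stat h.
apply: bigcup_measurable => n _; apply: measurableI; first exact: measurable_points_eq.
apply: measurableC; exact: measurable_sup_stat.
Qed.

End weights.
End null_hypothesis.

(** * Deviations under the alternative *)

Section alternative.
Context {R : realType} {d : measure_display} {Omega : measurableType d}.
Variables (N : Omega -> nat) (X : nat -> Omega -> R) (L : R).
Variable P : (R -> R) -> probability Omega R.
Hypothesis L0 : 0 < L.
Hypothesis NXP : poisson_experiment N X L P.
Variables (s : R -> R) (M : R).
Hypothesis is_s : intensities s.
Hypothesis s01 : forall x : R, 0 <= x <= 1 -> 0 <= s x <= M.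
Hypothesis M0 : 0 < M.

Local Notation cnt := (count_in N X).
Local Notation occ := (occupancy N X).

Lemma count_in_deviation (A : set R) (b D e v : R) : measurable A -> 0 < e ->
  b ^+ 2 * (L * mass s A) + 2 * D ^+ 2 * (L * mass s A) ^+ 2 <= v ->
  (P s [set w | (e <= `|charlier (L * mass s A) b D (cnt A w)|)%R] <= (v / e ^+ 2)%:E)%E.
Proof.
move=> mA e0 bv; have mc := measurable_count_in NXP mA.
have m0 : 0 <= L * mass s A by rewrite mulr_ge0 ?(ltW L0) // intensity_mass_ge0.
have [_ i2 _ I2] := charlier_moments mc m0 (poisson_count_in NXP is_s mA) b D.
apply: chebyshev_sqr => //; first exact: measurable_comp_nat.
rewrite -[leLHS]fineK ?lee_fin; last exact: integrable_fin_num.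
by rewrite -[leLHS]/(\int[P s]_w (charlier (L * mass s A) b D (cnt A w) ^+ 2)) I2.
Qed.

Lemma points_upper_tail (K beta : R) : 1 <= L -> 0 < beta -> M < K ->
  M / (K - M) ^+ 2 <= beta ->
  (P s [set w | (K * L < (N w)%:R)%R] <= beta%:E)%E.
Proof.
move=> L1 b0 MK Kb.
have NT w : cnt setT w = N w.
  rewrite /count_in; under eq_bigr do rewrite in_setT.
  by rewrite sum_nat_const muln1 card_ord.
have [ms _] := is_s; case: ms => ms _.
have mass_le : mass s setT <= M.
  rewrite /mass setTI -[leRHS]Rintegral01_cst; apply: le_Rintegral => //.
  - exact: integrable01_intensity ms s01.
  - exact: (@bounded_integrable01 _ (fun=> M) `|M|).
  - by move=> x /=; rewrite in_itv /= => /s01/andP[].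
have e0 : 0 < (K - M) * L by rewrite mulr_gt0 // subr_gt0.
(* With [b = 1] and [D = 0], [charlier] is the centered count, of variance at most [L * M]. *)
have := @count_in_deviation setT 1 0 ((K - M) * L) (L * M) measurableT e0.
rewrite expr1n mul1r expr0n mulr0 mul0r addr0 ler_pM2l // => /(_ mass_le) dev.
apply: le_trans (le_trans dev _); last first.
  rewrite lee_fin; apply: le_trans Kb.
  have KM2 : 0 < (K - M) ^+ 2 by rewrite exprn_gt0 // subr_gt0.
  have -> : L * M / ((K - M) * L) ^+ 2 = M / (K - M) ^+ 2 / L.
    by field; rewrite gt_eqF //= subr_eq0 gt_eqF.
  by rewrite ler_pdivrMr // ler_peMr // divr_ge0 // ltW.
have mN : measurable [set w | (K * L < (N w)%:R)%R].
  exact: (measurable_preimage_nat [set n | K * L < n%:R] (measurable_points NXP)).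
apply: le_measure; rewrite ?inE //.
  have := measurable_preimage_nat [set n | (K - M) * L <= `|charlier (L * mass s setT) 1 0 n|]
    (measurable_points NXP).
  by congr measurable; apply/seteqP; split => w /=; rewrite NT.
move=> w /= KN; rewrite NT /charlier mul0r addr0 mul1r ler_normr; apply/orP; left.
have : L * mass s setT <= L * M by rewrite ler_pM2l.
by rewrite mulrBl; lra.
Qed.

Section resolution.
Variable J : nat.

Let D : R := 2 ^+ J.
Let m (c : 'I_(2 ^ J)) : R := L * mass s (cell J c).
Let mt : R := L * mass s (cell 0 0).
Let theta := energy s J.
(** The coefficient of [N_c - m_c] in the expansion of [collisions]: [2 D m_c] comes from the cell
    and [- 2 mt] from the total. *)
Let b c : R := 2 * (D * m c - mt).

Let ms : measurable_fun (`[0, 1] : set R) s. Proof. by case: is_s => -[]. Qed.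
Let D0 : 0 < D. Proof. by rewrite exprn_gt0. Qed.

Let sum_m : \sum_c m c = mt.
Proof.
rewrite -mulr_sumr; congr (_ * _); elim: J => [|J' IH].
  by rewrite expn0 big_ord_recl big_ord0 addr0.
rewrite -IH expnS mul2n (big_ord_double _ _ (fun c => mass s (cell J'.+1 c))) /=.
by apply: eq_bigr => c _; rewrite [RHS](mass_cellS ms s01).
Qed.

Let energy_m : L ^+ 2 * theta = D * (\sum_c m c ^+ 2) - mt ^+ 2.
Proof.
rewrite /theta (energyE ms s01) /mt; under [in RHS]eq_bigr do rewrite exprMn.
by rewrite -mulr_sumr exprMn -/D; ring.
Qed.

(** Expands [k^2 - k = ((k - m)^2 - k) + 2 m (k - m) + m^2] in each cell and for the total. The
    linear part of the total is shared among the cells, which leaves it a purely quadratic term. *)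
Lemma collisions_charlier w : collisions (occ J w) =
  L ^+ 2 * theta + \sum_c charlier (m c) (b c) D (cnt (cell J c) w)
  - charlier mt 0 1 (cnt (cell 0 0) w).
Proof.
rewrite energy_m /collisions total_occupancy card_ord natrX -/D.
have tot : \sum_(c < 2 ^ J) (cnt (cell J c) w)%:R = (cnt (cell 0 0) w)%:R :> R.
  rewrite -natr_sum -(total_occupancy _ _ J) /total; congr (_%:R).
  by apply: eq_bigr => c _; rewrite ffunE.
have -> : \sum_c charlier (m c) (b c) D (cnt (cell J c) w) =
  D * \sum_c ((occ J w c)%:R ^+ 2 - (occ J w c)%:R) - D * (\sum_c m c ^+ 2)
  - 2 * mt * (\sum_(c < 2 ^ J) (cnt (cell J c) w)%:R) + 2 * mt * (\sum_c m c).
  rewrite !mulr_sumr -!sumrB -big_split /=; apply: eq_bigr => c _.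
  by rewrite ffunE /charlier /b; ring.
by rewrite tot sum_m /charlier; ring.
Qed.

(** The squares of the [b c] sum to [4 D L^2 theta] and [m c <= M L / D]. The variance of the linear
    part is thus proportional to the signal [theta], which can absorb it; the second term is the
    noise. *)
Lemma charlier_variance_le :
  \sum_c (b c ^+ 2 * m c + 2 * D ^+ 2 * m c ^+ 2) <=
  4 * M * L ^+ 3 * theta + 2 * D * M ^+ 2 * L ^+ 2.
Proof.
have mM c : 0 <= m c <= M * L / D.
  apply/andP; split; first by rewrite mulr_ge0 ?(ltW L0) // intensity_mass_ge0.
  have := mass_cell_le ms s01 (ltn_ord c); rewrite -/D => h.
  have -> : M * L / D = L * (M / D) by ring.
  by rewrite /m ler_pM2l.
apply: (@le_trans _ _ (\sum_c (b c ^+ 2 * (M * L / D) + 2 * D ^+ 2 * (M * L / D) ^+ 2))).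
  apply: ler_sum => c _; have /andP[m0 mle] := mM c; apply: lerD.
    by apply: ler_wpM2l => //; exact: sqr_ge0.
  apply: ler_wpM2l; first by rewrite mulr_ge0 // sqr_ge0.
  by rewrite ler_sqr ?nnegrE // (le_trans m0).
rewrite big_split /= sumr_const card_ord -mulr_suml.
have -> : \sum_c b c ^+ 2 = 4 * D * (L ^+ 2 * theta).
  rewrite energy_m.
  have -> : \sum_c b c ^+ 2 = 4 * D ^+ 2 * (\sum_c m c ^+ 2) - 8 * D * mt * (\sum_c m c)
     + \sum_(c < 2 ^ J) 4 * mt ^+ 2.
    rewrite !mulr_sumr -sumrB -big_split /=; apply: eq_bigr => c _; rewrite /b; ring.
  by rewrite sum_m sumr_const card_ord -[_ *+ (2 ^ J)]mulr_natl natrX -/D; ring.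
rewrite -[_ *+ (2 ^ J)]mulr_natl natrX -/D.
rewrite le_eqVlt; apply/orP; left; apply/eqP; field.
by rewrite gt_eqF.
Qed.

Lemma stat_lower_tail (beta x : R) : 1 <= L -> 0 < beta <= 1 ->
  2 * (16 * M / beta * L * Num.sqrt D) + L ^+ 2 * x < L ^+ 2 * theta / 2 ->
  (P s [set w | (stat N X L J w <= x)%R] <= (beta / 2)%:E)%E.
Proof.
(* [G] has the order of the noise, [L sqrt D]. Its constant 16 makes [beta / 4] times the cross term
   of [(L^2 theta / 2 + G)^2] dominate the linear variance [4 M L^3 theta]. *)
move=> L1 /andP[b0 b1]; set G := 16 * M / beta * L * Num.sqrt D => Gx.
have D1 : 1 <= D by rewrite /D exprn_ege1 // ler1n.
have sD : Num.sqrt D ^+ 2 = D by rewrite sqr_sqrtr // ltW.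
have sD1 : 1 <= Num.sqrt D by rewrite -sqrtr1 ler_wsqrtr.
have G0 : 0 < G by rewrite /G !mulr_gt0 ?invr_gt0 //; lra.
have th0 : 0 <= theta by exact: energy_ge0.
have e0 : 0 < L ^+ 2 * theta / 2 + G.
  by rewrite ltr_wpDl // divr_ge0 // mulr_ge0 // sqr_ge0.
have mcell (c : 'I_(2 ^ J)) := measurable_count_in NXP (measurable_cell J c).
pose Y w := \sum_c charlier (m c) (b c) D (cnt (cell J c) w).
have mY : measurable_fun setT Y.
  by apply: measurable_sum => c; exact: measurable_comp_nat.
have bG : beta * G = 16 * M * L * Num.sqrt D by rewrite /G; field; rewrite gt_eqF.
have ML0 : 0 < M * L by rewrite mulr_gt0.
have bG2 : 16 ^+ 2 * (M * L) ^+ 2 * D <= beta * G ^+ 2.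
  have -> : 16 ^+ 2 * (M * L) ^+ 2 * D = (beta * G) ^+ 2 by rewrite bG -[in LHS]sD; ring.
  rewrite exprMn; apply: ler_wpM2r; first exact: sqr_ge0.
  by rewrite expr2 ler_piMr // ltW.
have mA : measurable [set w | (L ^+ 2 * theta / 2 + G <= `|Y w|)%R].
  have mN : measurable_fun setT (fun w => `|Y w|) by exact: measurableT_comp.
  have -> : [set w | L ^+ 2 * theta / 2 + G <= `|Y w|] =
      setT `&` (fun w => `|Y w|) @^-1` `[L ^+ 2 * theta / 2 + G, +oo[.
    by apply/seteqP; split => w /=; rewrite in_itv /= andbT // => -[].
  exact: mN (measurable_itv _).
have dev1 : (P s [set w | (L ^+ 2 * theta / 2 + G <= `|Y w|)%R] <= (beta / 4)%:E)%E.
  apply: (@le_trans _ _ (((4 * M * L ^+ 3 * theta + 2 * D * M ^+ 2 * L ^+ 2) /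
      (L ^+ 2 * theta / 2 + G) ^+ 2)%:E)).
    apply: chebyshev_sqr => //.
    rewrite (charlier_sum_sqr b D mcell) ?lee_fin ?charlier_variance_le //.
    - by move=> c; rewrite mulr_ge0 ?(ltW L0) // intensity_mass_ge0.
    - by move=> c; exact: (poisson_count_in NXP is_s (measurable_cell J c)).
    - move=> c c' cc' i j.
      apply: (count_in_indep NXP is_s); [exact: measurable_cell|exact: measurable_cell|].
      exact: cell_disjoint.
  rewrite lee_fin ler_pdivrMr ?exprn_gt0 //.
  have t1 : 0 <= L ^+ 2 * theta by rewrite mulr_ge0 // sqr_ge0.
  have h1 : 16 * (M * L) * (L ^+ 2 * theta) <= beta * G * (L ^+ 2 * theta).
    apply: ler_wpM2r => //; rewrite bG.
    have -> : 16 * M * L * Num.sqrt D = 16 * (M * L) * Num.sqrt D by ring.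
    by rewrite ler_peMr // mulr_ge0 // ltW.
  have h2 : 0 <= beta * (L ^+ 2 * theta / 2) ^+ 2 by rewrite mulr_ge0 ?sqr_ge0 // ltW.
  have h3 : 0 <= (M * L) ^+ 2 * D by rewrite mulr_ge0 ?sqr_ge0 // ltW.
  have -> : 4 * M * L ^+ 3 * theta + 2 * D * M ^+ 2 * L ^+ 2 =
    4 * ((M * L) * (L ^+ 2 * theta)) + 2 * ((M * L) ^+ 2 * D) by ring.
  have -> : beta / 4 * (L ^+ 2 * theta / 2 + G) ^+ 2 =
    4^-1 * (beta * (L ^+ 2 * theta / 2) ^+ 2 + beta * G * (L ^+ 2 * theta) + beta * G ^+ 2).
    by field.
  lra.
have dev2 : (P s [set w | (G <= `|charlier mt 0 1 (cnt (cell 0 0) w)|)%R] <= (beta / 4)%:E)%E.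
  have mtM : 0 <= mt <= M * L.
    rewrite /mt mulr_ge0 ?(ltW L0) ?intensity_mass_ge0 //= [M * L]mulrC ler_pM2l //.
    by have := @mass_cell_le _ _ _ ms s01 0 0 isT; rewrite expr0 divr1.
  apply: (@le_trans _ _ ((2 * (M * L) ^+ 2) / G ^+ 2)%:E).
    apply: count_in_deviation => //; first exact: measurable_cell.
    rewrite expr0n mul0r add0r expr1n mulr1 ler_pM2l // -/mt.
    by case/andP: mtM => m0 mM; rewrite ler_sqr ?nnegrE // (le_trans m0).
  rewrite lee_fin ler_pdivrMr ?exprn_gt0 //.
  have : (M * L) ^+ 2 <= (M * L) ^+ 2 * D by rewrite ler_peMr // sqr_ge0.
  have : 0 <= (M * L) ^+ 2 by exact: sqr_ge0.
  lra.
have -> : (beta / 2)%:E = ((beta / 4)%:E + (beta / 4)%:E)%E by rewrite -EFinD; congr EFin; lra.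
have mB : measurable [set w | (G <= `|charlier mt 0 1 (cnt (cell 0 0) w)|)%R].
  exact: (measurable_preimage_nat [set n | G <= `|charlier mt 0 1 n|]
    (measurable_count_in NXP (measurable_cell 0 0))).
apply: le_trans (leeD dev1 dev2); apply: le_trans (measureU2 _ mA mB).
apply: le_measure; rewrite ?inE; [exact: (measurable_stat_le NXP)|exact: measurableU|].
move=> w /=; rewrite statE ler_pdivrMl ?exprn_gt0 // collisions_charlier -/(Y w) => cx.
(* If [Y] stays within [L^2 theta / 2 + G], then [stat <= x] and the hypothesis [Gx] push the term
   of the total above [G]. *)
have [h|h] := leP (L ^+ 2 * theta / 2 + G) `|Y w|; [by left|right].
move: h; rewrite ltr_norml => /andP[h _].
by rewrite ler_normr; apply/orP; left; lra.
Qed.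

End resolution.
End alternative.

(** * Tails under the null hypothesis *)

Section null_tail.
Context {R : realType}.
Implicit Types L K alpha : R.

Lemma expR_half_le2 : expR 2^-1 <= 2 :> R.
Proof. by have := @expR_le_quad R 2^-1 (lexx _); lra. Qed.

Lemma expR1_le4 : expR 1 <= 4 :> R.
Proof.
have -> : (1 : R) = 2^-1 + 2^-1 by lra.
rewrite expRD; have := expR_half_le2; have := expR_ge0 (2^-1 : R).
by set y := expR _; nra.
Qed.

Lemma ln2_ge_half : 2^-1 <= ln 2 :> R.
Proof. by rewrite -ler_expR lnK ?posrE // expR_half_le2. Qed.

(** As [ln] is 0 on nonpositive numbers, the assumption alone makes [ln L] and [L] positive. *)
Lemma lnln_ge1 L : 1 <= ln (ln L) ->
  [/\ 1 < L, L = expR (ln L), ln L = expR (ln (ln L)), 1 + ln (ln L) <= ln L & 1 + ln L <= L].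
Proof.
move=> t1.
have l0 : 0 < ln L.
  by rewrite ltNge; apply/negP => /ln0 l0; move: t1; rewrite l0 ler10.
have L0 : 0 < L.
  by rewrite ltNge; apply/negP => /ln0 L0; move: l0; rewrite L0 ltxx.
have LE : L = expR (ln L) by rewrite lnK.
have lE : ln L = expR (ln (ln L)) by rewrite lnK.
have h1 : 1 + ln L <= L by rewrite {2}LE; exact: expR_ge1Dx.
by split => //; [lra|rewrite {2}lE; exact: expR_ge1Dx].
Qed.

Lemma mem_levels L J : 1 <= ln (ln L) -> J \in levels L ->
  2 ^+ J * ln (ln L) ^+ 3 <= L ^+ 2.
Proof.
move=> t1 /[!mem_iota] /andP[J1 JA]; have [L1 _ _ _ _] := lnln_ge1 t1.
set t := ln (ln L) in t1 JA *.
have A0 : 0 < L ^+ 2 / t ^+ 3 by rewrite divr_gt0 // exprn_gt0 //; lra.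
have ln20 : 0 < ln 2 :> R by have := ln2_ge_half; lra.
have t30 : 0 < t ^+ 3 by rewrite exprn_gt0 //; lra.
rewrite -(ler_pdivlMr _ _ t30).
rewrite -ler_ln ?posrE ?exprn_gt0 // lnXn // -[ln 2 *+ J]mulr_natl -(ler_pdivlMr _ _ ln20).
by rewrite add1n ltnS -(prednK J1) truncn_gt_nat prednK in JA.
Qed.

Lemma size_levels_le L : 1 <= ln (ln L) -> (size (levels L))%:R <= 4 * ln L.
Proof.
move=> t1; have [L1 _ _ tl _] := lnln_ge1 t1; rewrite size_iota.
set t := ln (ln L) in t1 tl *; set q := ln _ / ln 2.
have ln2h := ln2_ge_half.
have q4 : q <= 4 * ln L.
  rewrite /q ler_pdivrMr; last by lra.
  apply: (@le_trans _ _ (ln (L ^+ 2))).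
    have t30 : 0 < t ^+ 3 by rewrite exprn_gt0 //; lra.
    have L20 : 0 < L ^+ 2 by rewrite exprn_gt0 //; lra.
    rewrite ler_ln ?posrE ?divr_gt0 // ler_pdivrMr //.
    by apply: ler_peMr; [exact: ltW|exact: exprn_ege1].
  rewrite lnXn; last by lra.
  by rewrite -[ln L *+ 2]mulr_natl; nra.
have [q0|q0] := leP 0 q; first by apply: le_trans q4; rewrite truncn_le.
have -> : Num.truncn q = 0%N by apply/eqP; rewrite -leqn0 truncn_le_nat; lra.
by lra.
Qed.

(** From [exp l >= l^6 / 6!] and [6! <= 2^10]. Both tail bounds spend this sixth power: as [t^2 l^4]
    on coarse partitions, as [l^4 l^2] on fine ones. *)
Lemma ln_pow6_le L : 1 <= ln (ln L) -> ln L ^+ 6 <= 2 ^+ 10 * L.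
Proof.
move=> t1; have [L1 LE _ tl _] := lnln_ge1 t1.
have l0 : 0 <= ln L by lra.
have := expR_ge1Dxn 5 l0; rewrite -LE => h.
have : ln L ^+ 6 / 6`!%:R <= L by lra.
rewrite ler_pdivrMr ?ltr0n // => /le_trans; apply.
by rewrite mulrC; apply: ler_wpM2r; [lra|rewrite -natrX ler_nat].
Qed.

Lemma size_levels_gt1 L : 1 <= ln (ln L) -> 2 ^+ 12 <= L -> (1 < size (levels L))%N.
Proof.
move=> t1 L2880; have [L1 LE _ tl _] := lnln_ge1 t1; rewrite size_iota.
have l6 := ln_pow6_le t1.
set t := ln (ln L) in t1 tl *; set l := ln L in tl l6.
have t3 : t ^+ 3 <= 2 ^+ 10 * L.
  apply: le_trans l6; apply: (@le_trans _ _ (l ^+ 3)).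
    by rewrite lerXn2r ?nnegrE; lra.
  by rewrite ler_weXn2l //; lra.
have A4 : 2 ^+ 2 <= L ^+ 2 / t ^+ 3.
  have t30 : 0 < t ^+ 3 by rewrite exprn_gt0 //; lra.
  by rewrite ler_pdivlMr //; nra.
have ln20 : 0 < ln 2 :> R by have := ln2_ge_half; lra.
rewrite truncn_gt_nat ler_pdivlMr // mulr_natl -lnXn // ler_ln ?posrE ?exprn_gt0 //.
exact: lt_le_trans A4.
Qed.

(** The choice [lam = 4 t / X], with [X = C L (sqrt (D t) + t)], gives [- 4 t] in the exponent. The
    two variance terms cost at most [t] each, since [X >= 2^7 t K L] and [X^2 >= 2^7 t D (K L)^2];
    this is the origin of the two terms of [X]. The last two hypotheses are the cap [4 lam D m <= 1]
    and the Chernoff term. *)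
Lemma throw_collisions_bernstein J n (C K L t z : R) (m : nat) :
  0 < K -> 1 < L -> 1 <= t -> 2 ^+ 7 * (K + 1) <= C -> n%:R <= K * L -> 1 <= z ->
  16 * t * 2 ^+ J * m%:R <= C * L * (Num.sqrt (2 ^+ J * t) + t) ->
  2 ^+ J * z ^- m * expR ((z - 1) * (K * L) / 2 ^+ J) <= expR (- (2 * t)) ->
  throw n (fun v : {ffun 'I_(2 ^ J) -> nat} =>
    (C * (Num.sqrt (2 ^+ J * t) + t) / L < (L ^+ 2)^-1 * collisions v)%R%:R) [ffun=> 0%N]
  <= 2 * expR (- (2 * t)).
Proof.
move=> K0 L1 t1 CK nKL z1; set D : R := 2 ^+ J; set sq := Num.sqrt (D * t) => mX zD.
have L0 : 0 < L by lra.
have t0 : 0 < t by lra.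
have C0 : 0 < C by lra.
have D0 : 0 < D by rewrite exprn_gt0.
have sq0 : 0 <= sq by exact: sqrtr_ge0.
have sq2 : sq ^+ 2 = D * t by rewrite sqr_sqrtr // mulr_ge0 // ltW.
set X := C * L * (sq + t) in mX.
have CL0 : 0 < C * L by rewrite mulr_gt0.
have X0 : 0 < X by rewrite mulr_gt0 // ltr_wpDl.
have KL0 : 0 < K * L by rewrite mulr_gt0.
have CKL : 2 ^+ 7 * (K * L) <= C * L.
  by rewrite mulrA; apply: ler_wpM2r; [exact: ltW|lra].
have X1 : 2 ^+ 7 * (t * (K * L)) <= X.
  apply: (@le_trans _ _ (C * L * t)); last by rewrite /X ler_pM2l //; lra.
  have -> : 2 ^+ 7 * (t * (K * L)) = 2 ^+ 7 * (K * L) * t by ring.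
  by apply: ler_wpM2r => //; exact: ltW.
have X2 : 2 ^+ 7 * (t * D * (K * L) ^+ 2) <= X ^+ 2.
  apply: (@le_trans _ _ ((C * L) ^+ 2 * (D * t))).
    have -> : 2 ^+ 7 * (t * D * (K * L) ^+ 2) = (2 ^+ 7 * (K * L) ^+ 2) * (D * t) by ring.
    apply: ler_wpM2r; first by rewrite mulr_ge0 // ltW.
    apply: (@le_trans _ _ ((2 ^+ 7 * (K * L)) ^+ 2)).
      by rewrite [(2 ^+ 7 * _) ^+ 2]exprMn; apply: ler_wpM2r; [exact: sqr_ge0|lra].
    by rewrite ler_sqr ?nnegrE // ?(ltW CL0) // mulr_ge0 // ltW.
  rewrite -sq2 -exprMn ler_sqr ?nnegrE // ?(ltW X0) ?(mulr_ge0 (ltW CL0) sq0) //.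
  by rewrite /X ler_pM2l //; lra.
have card_D : #|'I_(2 ^ J)|%:R = D :> R by rewrite card_ord natrX.
have cells : (0 < #|'I_(2 ^ J)|)%N by rewrite card_ord expn_gt0.
apply: (@le_trans _ _ (throw n (fun v : {ffun 'I_(2 ^ J) -> nat} =>
    (X < collisions v)%R%:R) [ffun=> 0%N])).
  apply: throw_le => v; rewrite [_ * collisions v]mulrC ltr_pdivlMr ?exprn_gt0 //.
  rewrite (_ : C * _ / L * L ^+ 2 = X) // /X; field.
  by rewrite gt_eqF.
have lam0 : 0 <= 4 * t / X by apply: divr_ge0; [lra|exact: ltW].
have lamDm : 4 * (4 * t / X) * (#|'I_(2 ^ J)|%:R * m%:R) <= 1.
  rewrite card_D (_ : _ * _ = 16 * t * D * m%:R / X); last by field; rewrite gt_eqF.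
  by rewrite ler_pdivrMr // mul1r.
apply: le_trans (throw_collisions_gt cells (ltW X0) lam0 lamDm nKL z1) _.
rewrite card_D [leRHS]mulr_natl mulr2n; apply: lerD => //.
rewrite ler_expR.
have -> : - (4 * t / X * X) + (4 * t / X) ^+ 2 * (8 * (X + D * (K * L))) * (K * L) =
  - (4 * t) + t * (2 ^+ 7 * (t * (K * L)) / X) + t * (2 ^+ 7 * (t * D * (K * L) ^+ 2) / X ^+ 2).
  by field; rewrite gt_eqF.
have q1 : 2 ^+ 7 * (t * (K * L)) / X <= 1 by rewrite ler_pdivrMr // mul1r.
have q2 : 2 ^+ 7 * (t * D * (K * L) ^+ 2) / X ^+ 2 <= 1 by rewrite ler_pdivrMr ?exprn_gt0 // mul1r.
have := ler_wpM2l (ltW t0) q1; have := ler_wpM2l (ltW t0) q2; lra.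
Qed.

End null_tail.

Section null_tail_bound.
Context {R : realType}.
Implicit Types L K alpha : R.

(* Coarse partitions have cells of moderate expected occupancy, and exponential moments bound the
   largest one; in fine partitions ([D > L ^ (3 / 2)]) no cell is likely to receive more than 6
   points. *)
Lemma coarse_tail J n (C K L l t : R) :
  0 < K -> 1 < L -> 1 <= t -> 1 + t <= l -> L = expR l -> l ^+ 6 <= 2 ^+ 10 * L ->
  2 ^+ 9 * (K + 1) <= C -> 2 ^+ J * t ^+ 3 <= L ^+ 2 -> (2 ^+ J) ^+ 2 <= L ^+ 3 -> n%:R <= K * L ->
  throw n (fun v : {ffun 'I_(2 ^ J) -> nat} =>
    (C * (Num.sqrt (2 ^+ J * t) + t) / L < (L ^+ 2)^-1 * collisions v)%R%:R) [ffun=> 0%N]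
  <= 2 * expR (- (2 * t)).
Proof.
move=> K0 L1' t1 tl LE Ll6 CK DL DL3 nKL.
set D : R := 2 ^+ J in DL DL3 *.
have D1 : 1 <= D by rewrite exprn_ege1 // ler1n.
have l0 : 0 < l by lra.
have t0 : 0 < t by lra.
have Dt0 : 0 <= D * t by apply: mulr_ge0; lra.
have sq0 : 0 <= Num.sqrt (D * t) by exact: sqrtr_ge0.
have sq2 : Num.sqrt (D * t) ^+ 2 = D * t by rewrite sqr_sqrtr.
(* With [z = e], the first term of [q] compensates [(e - 1) K L / D], and the second leaves
   [D exp (- 4 l) <= exp (- 2 l)], as [D <= L^2]. *)
pose q := 3 * (K * L) / D + 4 * l; pose m := (Num.truncn q).+1.
have q0 : 0 <= q.
  by apply: addr_ge0; [apply: divr_ge0; [apply: mulr_ge0; [lra|apply: mulr_ge0; lra]|lra]|lra].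
have qm : q <= m%:R by rewrite ltW // truncnS_gt.
have mq : m%:R <= q + 1 by rewrite /m -natr1 lerD2r truncn_le.
have e4 := @expR1_le4 R.
(* Here [D^2 <= L^3] enters: the square of the left side is at most [l^6 L^3]. This makes the
   logarithmic part of [m] compatible with the cap. *)
have tl2D : t * l ^+ 2 * D <= 32 * L ^+ 2.
  rewrite -ler_sqr ?nnegrE ?mulr_ge0 ?sqr_ge0 //; try lra.
  have -> : (t * l ^+ 2 * D) ^+ 2 = (t ^+ 2 * l ^+ 4) * D ^+ 2 by ring.
  apply: (@le_trans _ _ (2 ^+ 10 * L * L ^+ 3)).
    apply: ler_pM => //; try by rewrite ?mulr_ge0 ?sqr_ge0 ?exprn_ge0 // ltW.
    apply: le_trans Ll6; rewrite (_ : l ^+ 6 = l ^+ 2 * l ^+ 4); last by ring.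
    apply: ler_wpM2r; first by rewrite exprn_ge0 // ltW.
    by rewrite ler_sqr ?nnegrE; lra.
  have -> : 2 ^+ 10 * L * L ^+ 3 = 2 ^+ 10 * L ^+ 4 by ring.
  by rewrite le_eqVlt; apply/orP; left; apply/eqP; ring.
apply: (@throw_collisions_bernstein _ J n C K L t (expR 1) m) => //.
+ by lra.
+ by rewrite -[leLHS]expR0 ler_expR.
+ apply: (@le_trans _ _ (16 * t * D * (q + 1))).
    by apply: ler_wpM2l => //; rewrite !mulr_ge0 //; lra.
  have -> : 16 * t * D * (q + 1) = 48 * K * L * t + 16 * t * D * (4 * l + 1).
    by rewrite /q; field; rewrite gt_eqF //; lra.
  have h1 : 48 * K * L * t <= C * L * t.
    apply: ler_wpM2r; first exact: ltW.
    by apply: ler_wpM2r; [lra|lra].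
  have tD0 : 0 <= t * D by rewrite mulr_ge0 //; lra.
  have h2 : 16 * t * D * (4 * l + 1) <= 80 * (t * D * l).
    have l1' : 1 <= l by lra.
    have := ler_wpM2l tD0 l1'; lra.
  have h3 : 80 * (t * D * l) <= C * L * Num.sqrt (D * t).
    have CL : 2 ^+ 9 * L <= C * L by apply: ler_wpM2r; [lra|lra].
    apply: (@le_trans _ _ (2 ^+ 9 * L * Num.sqrt (D * t))); last by apply: ler_wpM2r.
    rewrite -ler_sqr ?nnegrE; last 2 first.
    - by apply: mulr_ge0; [lra|apply: mulr_ge0; [exact: tD0|lra]].
    - by apply: mulr_ge0; [apply: mulr_ge0; lra|exact: sq0].
    have -> : (80 * (t * D * l)) ^+ 2 = 80 ^+ 2 * (t * l ^+ 2 * D) * (D * t) by ring.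
    rewrite exprMn sq2; apply: ler_wpM2r; first by rewrite mulrC.
    have : 0 <= L ^+ 2 by exact: sqr_ge0.
    rewrite exprMn; lra.
  by rewrite mulrDr; lra.
+ rewrite -/D (_ : expR 1 ^- m = expR (- m%:R)); last first.
    by rewrite expRN -[in RHS](mulr1 m%:R) expRM_natl.
  rewrite -mulrA -expRD.
  have DE : D <= expR (2 * l).
    rewrite mulr_natl mulr2n expRD -LE -expr2; apply: le_trans DL.
    by rewrite ler_peMr ?exprn_ege1 //; lra.
  apply: (@le_trans _ _ (expR (2 * l) * expR (- (4 * l)))).
    apply: ler_pM => //; [lra|].
    rewrite ler_expR; have KLD : 0 <= K * L / D by rewrite divr_ge0 ?mulr_ge0 //; lra.
    have : (expR 1 - 1) * (K * L / D) <= 3 * (K * L / D).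
      by apply: ler_wpM2r => //; lra.
    by rewrite /q in qm; lra.
  by rewrite -expRD ler_expR; lra.
Qed.

Lemma fine_tail J n (C K L l t : R) :
  0 < K -> 1 < L -> 1 <= t -> 1 + t <= l -> l ^+ 6 <= 2 ^+ 10 * L ->
  expR (- (2 * t)) = (l ^+ 2)^-1 -> 2 ^+ 12 * (K + 1) ^+ 6 <= l ->
  2 ^+ 9 * (K + 1) <= C -> 2 ^+ J * t ^+ 3 <= L ^+ 2 -> L ^+ 3 < (2 ^+ J) ^+ 2 -> n%:R <= K * L ->
  throw n (fun v : {ffun 'I_(2 ^ J) -> nat} =>
    (C * (Num.sqrt (2 ^+ J * t) + t) / L < (L ^+ 2)^-1 * collisions v)%R%:R) [ffun=> 0%N]
  <= 2 * expR (- (2 * t)).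
Proof.
move=> K0 L1' t1 tl Ll6 eE l1l CK DL DL3 nKL.
have l4 : 2 ^+ 12 * K ^+ 6 <= l ^+ 4.
  have K6 : K ^+ 6 <= (K + 1) ^+ 6 by rewrite lerXn2r ?nnegrE; lra.
  apply: (@le_trans _ _ l); first by lra.
  by rewrite -[leLHS]expr1 ler_weXn2l //; lra.
clear l1l; set D : R := 2 ^+ J in DL DL3 *.
have D1 : 1 <= D by rewrite exprn_ege1 // ler1n.
have l0 : 0 < l by lra.
have t0 : 0 < t by lra.
have Dt0 : 0 <= D * t by apply: mulr_ge0; lra.
have sq0 : 0 <= Num.sqrt (D * t) by exact: sqrtr_ge0.
have sq2 : Num.sqrt (D * t) ^+ 2 = D * t by rewrite sqr_sqrtr.
have DLL : L <= D.
  rewrite leNgt; apply/negP => /ltW DL'.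
  have h1 : D ^+ 2 <= L ^+ 2 by apply: lerXn2r; rewrite ?nnegrE; lra.
  have h2 : L ^+ 2 <= L ^+ 3 by rewrite ler_weXn2l // ltW.
  by lra.
have D0 : 0 < D by lra.
have L0 : 0 < L by lra.
have KL0 : 0 < K * L by rewrite mulr_gt0.
(* For this [z] the Chernoff exponent is 1, and with [m = 6] the rest, [D z^-6], is at most
   [K^6 L^6 / D^5 <= K^6 / L], since [D^5 >= L^7]. *)
have z1 : 1 <= 1 + D / (K * L) by rewrite lerDl divr_ge0 // ltW.
apply: (@throw_collisions_bernstein _ J n C K L t (1 + D / (K * L)) 6) => //.
+ by lra.
+ apply: (@le_trans _ _ (C * L * Num.sqrt (D * t))); last first.
    by rewrite ler_pM2l ?mulr_gt0 //; [lra|lra].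
  have CL : 2 ^+ 9 * L <= C * L by apply: ler_wpM2r; [lra|lra].
  apply: (@le_trans _ _ (2 ^+ 9 * L * Num.sqrt (D * t))); last by apply: ler_wpM2r.
  rewrite -ler_sqr ?nnegrE; last 2 first.
  - by apply: mulr_ge0; [apply: mulr_ge0; [lra|exact: ltW]|lra].
  - by apply: mulr_ge0; [apply: mulr_ge0; lra|exact: sq0].
  rewrite -/D [X in _ <= X]exprMn sq2.
  have -> : (16 * t * D * 6%:R) ^+ 2 = 96 ^+ 2 * (D * t) * (D * t) by ring.
  apply: ler_wpM2r; first by rewrite mulr_ge0 // ltW.
  have : D * t <= L ^+ 2.
    apply: le_trans DL; rewrite ler_pM2l //.
    by rewrite -[leLHS]expr1 ler_weXn2l.
  have : 0 <= L ^+ 2 by exact: sqr_ge0.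
  rewrite exprMn; lra.
+ have e4 := @expR1_le4 R.
  rewrite -/D eE (_ : (1 + D / (K * L) - 1) * (K * L) / D = 1); last first.
    by field; rewrite !gt_eqF.
  have zD : (1 + D / (K * L)) ^- 6 <= (K * L / D) ^+ 6.
    rewrite -[K * L / D]invrK invf_div exprVn lef_pV2 ?posrE ?exprn_gt0 //; last 2 first.
    - lra.
    - by rewrite divr_gt0.
    by rewrite lerXn2r ?nnegrE ?lerDr //; [rewrite divr_ge0 // ltW|lra].
  apply: (@le_trans _ _ (D * (K * L / D) ^+ 6 * 4)).
    apply: ler_pM => //; last by rewrite ler_pM2l.
      by apply: mulr_ge0; [exact: ltW|rewrite invr_ge0 exprn_ge0 // (le_trans ler01)].
  have -> : D * (K * L / D) ^+ 6 * 4 = 4 * K ^+ 6 * L ^+ 6 / D ^+ 5.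
    by field; rewrite gt_eqF.
  rewrite ler_pdivrMr ?exprn_gt0 // [leRHS]mulrC ler_pdivlMr ?exprn_gt0 //.
  apply: (@le_trans _ _ (L ^+ 7)); last first.
    rewrite (_ : D ^+ 5 = D ^+ 2 * D ^+ 2 * D); last by ring.
    rewrite (_ : L ^+ 7 = L ^+ 3 * L ^+ 3 * L); last by ring.
    have L30 : 0 <= L ^+ 3 by rewrite exprn_ge0 // ltW.
    apply: ler_pM => //; [by rewrite mulr_ge0|exact: ltW|].
    by apply: ler_pM => //; exact: ltW.
  rewrite (_ : L ^+ 7 = L * L ^+ 6); last by ring.
  rewrite [leLHS](_ : _ = (4 * K ^+ 6 * l ^+ 2) * L ^+ 6); last by ring.
  apply: ler_wpM2r; first by rewrite exprn_ge0 // ltW.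
  have : 2 ^+ 12 * K ^+ 6 * l ^+ 2 <= l ^+ 6.
    rewrite (_ : l ^+ 6 = l ^+ 4 * l ^+ 2); last by ring.
    by apply: ler_wpM2r; first exact: sqr_ge0.
  by lra.
Qed.

Lemma null_tail K alpha : 0 < K -> 0 < alpha ->
  exists C L1, [/\ 0 < C, 0 < L1 & forall L, L1 <= L -> 1 <= ln (ln L) ->
  (1 < size (levels L))%N /\ forall J n, J \in levels L -> n%:R <= K * L ->
  throw n (fun v : {ffun 'I_(2 ^ J) -> nat} =>
    (C * (Num.sqrt (2 ^+ J * ln (ln L)) + ln (ln L)) / L < (L ^+ 2)^-1 * collisions v)%R%:R)
    [ffun=> 0%N] <= alpha / (size (levels L))%:R].
Proof.
move=> K0 a0; pose C := 2 ^+ 9 * (K + 1).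
(* The first term serves the fine partitions and ensures [L >= 2^12], hence two levels. The second
   gives [2 exp (- 2 t) = 2 / l^2 <= alpha / (4 l)], while there are at most [4 l] levels. *)
pose l1 := 2 ^+ 12 * (K + 1) ^+ 6 + 8 / alpha.
exists C, (expR l1); split; [by rewrite /C; lra|exact: expR_gt0|].
move=> L L1 t1; have [L1' LE lE tl lL] := lnln_ge1 t1.
have Ll6 := ln_pow6_le t1.
have K61 : 1 <= (K + 1) ^+ 6 by apply: exprn_ege1; lra.
have a8 : 0 < 8 / alpha by rewrite divr_gt0.
have [l1K l1a] : 2 ^+ 12 * (K + 1) ^+ 6 <= ln L /\ 8 / alpha <= ln L.
  have : l1 <= ln L by rewrite -ler_expR -LE.
  by rewrite /l1 => l1l; split; lra.
clear L1; clearbody l1.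
have sz1 : (1 < size (levels L))%N by apply: size_levels_gt1 => //; lra.
split => // J n JL nKL.
have DL := mem_levels t1 JL.
have szl := size_levels_le t1.
set t := ln (ln L) in t1 lE tl DL *; set l := ln L in LE lE tl lL Ll6 l1K l1a szl.
set D : R := 2 ^+ J in DL *.
have D1 : 1 <= D by rewrite exprn_ege1 // ler1n.
have l0 : 0 < l by lra.
have t0 : 0 < t by lra.
have CK : 2 ^+ 9 * (K + 1) <= C by [].
clearbody C.
have eE : expR (- (2 * t)) = (l ^+ 2)^-1.
  by rewrite expRN mulr_natl mulr2n expRD -lE expr2.
apply: (@le_trans _ _ (2 * expR (- (2 * t)))); last first.
  have sz0 : 0 < (size (levels L))%:R :> R by rewrite ltr0n ltnW.
  rewrite eE ler_pdivlMr // mulrAC ler_pdivrMr ?exprn_gt0 //.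
  have al : 8 <= alpha * l.
    by rewrite mulrC -ler_pdivrMr.
  have := ler_wpM2r (ltW l0) al; rewrite expr2; lra.
have [DL3|DL3] := leP (D ^+ 2) (L ^+ 3).
  exact: (@coarse_tail _ _ C K L l t).
exact: (@fine_tail _ _ C K L l t).
Qed.

End null_tail_bound.

(** * Rates *)

Section rates.
Context {R : realType}.
Implicit Types (delta r t L x y p : R).

Lemma powR_expR x p : (expR x) `^ p = expR (p * x).
Proof. by rewrite /powR gt_eqF ?expR_gt0 // expRK. Qed.

Lemma sqrt_expR x : Num.sqrt (expR x) = expR (x / 2).
Proof.
have -> : expR x = expR (x / 2) ^+ 2 by rewrite expr2 -expRD; congr expR; lra.
by rewrite sqrtr_sqr ger0_norm // expR_ge0.
Qed.

Lemma ler_powRN x y p : 0 <= p -> 0 < x -> x <= y -> y `^ (- p) <= x `^ (- p).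
Proof.
move=> p0 x0 xy; have y0 : 0 < y by exact: lt_le_trans xy.
rewrite !powRN lef_pV2 ?posrE ?powR_gt0 //.
by apply: ge0_ler_powR; rewrite // nnegrE ltW.
Qed.

(* The value of [2 ^ J] at which the bias [r^2 2^(-2 J delta)] and the deviation [2^(J / 2) y]
   balance, [y] standing for [sqrt (ln ln L) / L]. *)
Definition balance delta r y : R := (r ^+ 2 / y) `^ (2 / (4 * delta + 1)).

Definition balanced_rate delta r y : R :=
  r `^ (2 / (4 * delta + 1)) * y `^ (4 * delta / (4 * delta + 1)).

Lemma balanceE delta r y : 0 < delta -> 0 < r -> 0 < y ->
  [/\ 0 < balance delta r y, Num.sqrt (balance delta r y) * y = balanced_rate delta r y &
    r ^+ 2 * (balance delta r y) `^ (- (2 * delta)) = balanced_rate delta r y].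
Proof.
move=> d0 r0 y0; rewrite /balance /balanced_rate.
have -> : r = expR (ln r) by rewrite lnK.
have -> : y = expR (ln y) by rewrite lnK.
set a := ln r; set b := ln y.
have -> : expR a ^+ 2 / expR b = expR (2 * a - b).
  by rewrite expRD expRN mulr_natl mulr2n expRD expr2.
rewrite !powR_expR sqrt_expR.
have d1 : 4 * delta + 1 != 0 by apply: lt0r_neq0; lra.
split; first exact: expR_gt0.
  by rewrite -!expRD; congr expR; field.
rewrite [expR a ^+ 2]expr2 -!expRD; congr expR; field.
exact: d1.
Qed.

Lemma levels_max L : 1 <= ln (ln L) -> (1 < size (levels L))%N ->
  exists n, [/\ (0 < n)%N, forall J, (J \in levels L) = (0 < J <= n)%N &
    L ^+ 2 / ln (ln L) ^+ 3 < 2 ^+ n.+1].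
Proof.
move=> t1; have [L1 _ _ _ _] := lnln_ge1 t1; rewrite size_iota => sz.
exists (Num.truncn (ln (L ^+ 2 / ln (ln L) ^+ 3) / ln 2)).
split; [exact: ltnW|by move=> J; rewrite mem_iota add1n ltnS|].
have ln20 : 0 < ln 2 :> R by have := @ln2_ge_half R; lra.
have t30 : 0 < ln (ln L) ^+ 3 by rewrite exprn_gt0 //; lra.
have A0 : 0 < L ^+ 2 / ln (ln L) ^+ 3 by rewrite divr_gt0 // exprn_gt0 //; lra.
rewrite -ltr_ln ?posrE ?exprn_gt0 // lnXn // -[ltRHS]mulr_natl -ltr_pdivrMr //.
exact: truncnS_gt.
Qed.

(** [J] is the least level with [2 ^ J >= balance], or the largest level if there is none. Each term
    of the rate in the theorem has its case: the balanced one, the bias at the largest level, and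
    the deviation at level 1. *)
Lemma level_choice delta r L : 0 < delta -> 0 < r -> 1 <= ln (ln L) ->
  (1 < size (levels L))%N ->
  exists2 J, J \in levels L &
   Num.sqrt (2 ^+ J * ln (ln L)) / L <=
     2 * balanced_rate delta r (Num.sqrt (ln (ln L)) / L) + 2 * (ln (ln L) / L) /\
   r ^+ 2 * (2 ^+ J) `^ (- (2 * delta)) <=
     balanced_rate delta r (Num.sqrt (ln (ln L)) / L) +
     2 `^ (2 * delta) * (r ^+ 2 * (ln (ln L) ^+ 3 / L ^+ 2) `^ (2 * delta)).
Proof.
move=> d0 r0 t1 sz; have [L1 _ _ _ _] := lnln_ge1 t1.
have [n [n0 levelsP max_lt]] := levels_max t1 sz; clear sz.
set t := ln (ln L) in t1 max_lt *; set y := Num.sqrt t / L.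
have L0 : 0 < L by lra.
have t0 : 0 < t by lra.
have y0 : 0 < y by rewrite divr_gt0 // sqrtr_gt0.
have [B0 B1 B2] := balanceE d0 r0 y0.
set B := balance delta r y in B0 B1 B2; set e := balanced_rate delta r y in B1 B2 *.
have e0 : 0 <= e by rewrite -B1 mulr_ge0 ?sqrtr_ge0 // ltW.
have d2 : 0 <= 2 * delta by lra.
have term0 : 0 <= 2 `^ (2 * delta) * (r ^+ 2 * (t ^+ 3 / L ^+ 2) `^ (2 * delta)).
  by apply: mulr_ge0; [exact: powR_ge0|apply: mulr_ge0; [exact: sqr_ge0|exact: powR_ge0]].
have tL0 : 0 <= t / L by rewrite divr_ge0 // ltW.
have sqrt_le c : 0 <= c -> Num.sqrt (c * t) / L = Num.sqrt c * y.
  by move=> c0; rewrite sqrtrM // /y mulrA.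
have [BJ|JB] := leP B (2 ^+ n).
  have ex : exists J, (0 < J)%N && (B <= 2 ^+ J) by exists n; rewrite BJ n0.
  case: (ex_minnP ex) => J /andP[J0 BJ'] Jmin; exists J.
    by rewrite levelsP J0; apply: Jmin; rewrite BJ n0.
  split; last first.
    rewrite -[leLHS]addr0; apply: lerD => //; rewrite -B2.
    by apply: ler_wpM2l; [exact: sqr_ge0|exact: ler_powRN].
  (* At level 1, which may lie far above [balance], the deviation is at most [2 t / L]. At higher
     levels, minimality puts the preceding power of 2 below [balance]. *)
  case: J J0 BJ' Jmin => // -[_ _ _|J _ _ Jmin].
    rewrite expr1 -[leLHS]add0r; apply: lerD; first by rewrite mulr_ge0.
    rewrite mulrA; apply: ler_wpM2r; first by rewrite invr_ge0 ltW.
    rewrite -[leRHS]ger0_norm; last by lra.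
    rewrite -sqrtr_sqr; apply: ler_wsqrtr; rewrite expr2 ler_peMr //; lra.
  rewrite -[leLHS]addr0; apply: lerD; last by rewrite mulr_ge0.
  have JB : 2 ^+ J.+1 < B.
    by rewrite ltNge; apply/negP => h; have := Jmin J.+1; rewrite h ltnn => /(_ isT).
  rewrite sqrt_le ?exprn_ge0 // -B1 [leRHS]mulrA; apply: ler_wpM2r; first exact: ltW.
  rewrite -[X in _ <= X * _](ger0_norm (_ : 0 <= 2)) // -sqrtr_sqr -sqrtrM ?sqr_ge0 //.
  by apply: ler_wsqrtr; rewrite exprS; lra.
exists n; first by rewrite levelsP n0 leqnn.
split.
  rewrite sqrt_le ?exprn_ge0 //; apply: (@le_trans _ _ (1 * e)).
    by rewrite mul1r -B1; apply: ler_wpM2r; [exact: ltW|apply: ler_wsqrtr; exact: ltW].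
  by lra.
rewrite -[leLHS]add0r; apply: lerD => //.
rewrite [leRHS]mulrCA; apply: ler_wpM2l; first exact: sqr_ge0.
have A0 : 0 < L ^+ 2 / t ^+ 3 by rewrite divr_gt0 // exprn_gt0.
have A2 : L ^+ 2 / t ^+ 3 / 2 <= 2 ^+ n.
  by rewrite ler_pdivrMr // [leRHS]mulrC -exprS ltW.
apply: le_trans (ler_powRN d2 _ A2) _; first by rewrite divr_gt0.
rewrite powRN -powR_inv1 ?powR_ge0 // -powRrM mulrN1 powRN.
rewrite -powRM ?powR_ge0 //; last by rewrite divr_ge0 ?exprn_ge0 // ltW.
rewrite le_eqVlt; apply/orP; left; apply/eqP.
rewrite -[LHS]powR_inv1 ?powR_ge0 // powRAC powR_inv1; last by rewrite divr_ge0 // ltW.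
by congr (_ `^ _); field; rewrite !gt_eqF.
Qed.

(** As [ln L = exp t >= t^2 / 2], this bounds [c t - q ln L] uniformly in [L]. *)
Lemma quad_bound (c q t : R) : 0 < q -> c * t - q * (t ^+ 2 / 2) <= c ^+ 2 / (2 * q).
Proof.
move=> q0; rewrite ler_pdivlMr ?mulr_gt0 // -subr_ge0.
have -> : c ^+ 2 - (c * t - q * (t ^+ 2 / 2)) * (2 * q) = (q * t - c) ^+ 2 by field.
exact: sqr_ge0.
Qed.

Lemma rate_terms_le delta r : 0 < delta -> 0 < r ->
  exists2 K : R, 0 < K & forall L, 1 <= ln (ln L) ->
  r `^ (2 / (4 * delta + 1)) *
     (Num.sqrt (ln (ln L)) / L) `^ (4 * delta / (4 * delta + 1))
   + r ^+ 2 * (ln (ln L) ^+ 3 / L ^+ 2) `^ (2 * delta) + ln (ln L) / L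
  <= K * (Num.sqrt (ln (ln L)) / L) `^ (4 * delta / (4 * delta + 1)).
Proof.
move=> d0 r0; set p := 4 * delta / (4 * delta + 1).
have p0 : 0 < p by rewrite divr_gt0 //; lra.
have p1 : p < 1 by rewrite ltr_pdivrMr; lra.
have pd : p < 4 * delta by rewrite ltr_pdivrMr ?ltr_pMr //; lra.
(* [k1] and [k2] bound the ratios of the last two terms to the main one. Up to powers of [t], the
   terms are of order [L^(- p)], [L^(- 4 delta)] and [L^-1], with [p < 4 delta] and [p < 1]. *)
set k1 := expR ((6 * delta) ^+ 2 / (2 * (4 * delta - p))).
set k2 := expR (1 ^+ 2 / (2 * (1 - p))).
exists (r `^ (2 / (4 * delta + 1)) + r ^+ 2 * k1 + k2).
  apply: addr_gt0; last exact: expR_gt0.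
  by apply: addr_gt0; [exact: powR_gt0|apply: mulr_gt0; [exact: exprn_gt0|exact: expR_gt0]].
move=> L t1; have [L1 LE lE tl _] := lnln_ge1 t1.
set t := ln (ln L) in t1 lE tl *; set l := ln L in LE lE tl.
have tE : t = expR (ln t) by rewrite lnK // posrE; lra.
set a := ln t in tE.
have a0 : 0 <= a by rewrite ln_ge0.
have at_ : a <= t by rewrite [leRHS]tE (le_trans _ (expR_ge1Dx _)) //; lra.
have lt2 : t ^+ 2 / 2 <= l.
  have t0 : 0 <= t by lra.
  have := expR_ge1Dxn 1 t0; rewrite -lE (_ : 2`!%:R = 2) //; lra.
have yE : Num.sqrt t / L = expR (a / 2 - l).
  by rewrite tE sqrt_expR LE -expRN -expRD -/a.
rewrite yE powR_expR !mulrDl; apply: lerD; first apply: lerD => //.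
  rewrite -mulrA; apply: ler_wpM2l; first exact: sqr_ge0.
  have -> : t ^+ 3 / L ^+ 2 = expR (3 * a - 2 * l).
    by rewrite expRD expRN !expRM_natl -tE -LE.
  rewrite powR_expR -expRD ler_expR.
  have q0 : 0 < 4 * delta - p by lra.
  have h1 := quad_bound (6 * delta) t q0.
  have h2 : (4 * delta - p) * (t ^+ 2 / 2) <= (4 * delta - p) * l by rewrite ler_pM2l.
  have h3 : 6 * delta * a <= 6 * delta * t by apply: ler_wpM2l; lra.
  have h4 : 0 <= p * a by rewrite mulr_ge0 // ltW.
  move: h1; set X := _ / (2 * _); lra.
have -> : t / L = expR (a - l) by rewrite expRD expRN -tE -LE.
rewrite -expRD ler_expR.
have q0 : 0 < 1 - p by lra.
have h1 := quad_bound 1 t q0.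
have h2 : (1 - p) * (t ^+ 2 / 2) <= (1 - p) * l by rewrite ler_pM2l.
have h4 : 0 <= p * a by rewrite mulr_ge0 // ltW.
move: h1; set X := _ / (2 * _); lra.
Qed.

End rates.

(** * Power of the test and separation rate *)

(** Half of [beta] is spent on having more than [K L] points, where the null tail bound is silent,
    and half on [stat] falling below that bound. *)
Lemma test1_power {R : realType} (alpha beta M : R) :
  0 < alpha < 1 -> 0 < beta < 1 -> 0 < M ->
  exists C L1, [/\ 0 < C, 0 < L1 & forall (L : R), L1 <= L -> 1 <= ln (ln L) ->
  (1 < size (levels L))%N /\
  forall (d : measure_display) (Omega : measurableType d)
    (N : Omega -> nat) (X : nat -> Omega -> R) (P : (R -> R) -> probability Omega R),
  poisson_experiment N X L P ->
  forall (s : R -> R) (J : nat), intensities s -> (forall x : R, 0 <= x <= 1 -> 0 <= s x <= M) ->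
  J \in levels L ->
  C * (Num.sqrt (2 ^+ J * ln (ln L)) + ln (ln L)) / L < energy s J ->
  (P s [set w | test1 N X L P alpha w = 0%N] <= beta%:E)%E].
Proof.
move=> a01 /andP[b0 b1] M0; case/andP: (a01) => a0 _.
(* Large enough for Chebyshev's inequality to give [N > K L] probability at most [beta / 2]. *)
pose K := M + 4 * (M + 1) / beta.
have MK : M < K by rewrite /K ltrDl divr_gt0 // mulr_gt0 //; lra.
have K0 : 0 < K by exact: lt_trans MK.
have Kb : M / (K - M) ^+ 2 <= beta / 2.
  have -> : K - M = 4 * (M + 1) / beta by rewrite /K; ring.
  rewrite ler_pdivrMr; last by rewrite exprn_gt0 // divr_gt0 // mulr_gt0 //; lra.
  have -> : beta / 2 * (4 * (M + 1) / beta) ^+ 2 = 8 * (M + 1) ^+ 2 / beta.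
    by field; rewrite gt_eqF.
  rewrite ler_pdivlMr //; apply: (@le_trans _ _ (M * 1)).
    by rewrite ler_pM2l // ltW.
  by rewrite mulr1; nra.
have [C [L1 [C0 L10 tail]]] := null_tail K0 a0.
(* [C] covers the quantile and [32 M / beta] twice the deviation [G]; the factor 2 is due to
   [theta / 2] in [stat_lower_tail]. *)
exists (2 * (32 * M / beta + C)), L1; split => //.
  by rewrite mulr_gt0 // addr_gt0 // divr_gt0 // mulr_gt0.
move=> L LL1 t1; have [sz {}tail] := tail L LL1 t1; split => //.
have [L_gt1 _ _ _ _] := lnln_ge1 t1.
move=> d Omega N X P NXP s J is_s s01 JL.
set t := ln (ln L) in t1 tail *; set D : R := 2 ^+ J => theta_gt.
have L0 : 0 < L by lra.
set x := C * (Num.sqrt (D * t) + t) / L.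
have D0 : 0 < D by rewrite exprn_gt0.
have sD : Num.sqrt D <= Num.sqrt (D * t) + t.
  rewrite -[leLHS]addr0; apply: lerD; last by lra.
  by apply: ler_wsqrtr; rewrite ler_peMr // ltW.
have stat_tail : (P s [set w | (stat N X L J w <= x)%R] <= (beta / 2)%:E)%E.
  apply: (stat_lower_tail L0 NXP is_s s01 M0); rewrite ?b0 ?ltW //.
  rewrite -/D; set S := Num.sqrt (D * t) + t in sD theta_gt x *.
  move: theta_gt; rewrite ltr_pdivrMr // => theta_gt.
  have h1 : 16 * M / beta * L * Num.sqrt D <= 16 * M / beta * L * S.
    by apply: ler_wpM2l => //; rewrite mulr_ge0 ?divr_ge0 ?mulr_ge0 // ltW.
  have h2 : L ^+ 2 * x = C * S * L by rewrite /x; field; rewrite gt_eqF.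
  rewrite h2; apply: (@le_lt_trans _ _ (L * ((32 * M / beta + C) * S))).
    have -> : L * ((32 * M / beta + C) * S) = 2 * (16 * M / beta * L * S) + C * S * L by ring.
    by rewrite lerD2r ler_pM2l.
  have -> : L ^+ 2 * energy s J / 2 = L * (energy s J * L / 2) by ring.
  rewrite ltr_pM2l //; lra.
have N_tail : (P s [set w | (K * L < (N w)%:R)%R] <= (beta / 2)%:E)%E.
  by apply: (points_upper_tail L0 NXP is_s s01 M0 _ _ MK Kb); [exact: ltW|rewrite divr_gt0].
have mtest := measurable_test_eq0 NXP (levels L) alpha.
have mstat := measurable_stat_le NXP J x.
have mN : measurable [set w | (K * L < (N w)%:R)%R].
  exact: (measurable_preimage_nat [set n | K * L < n%:R] (measurable_points NXP)).
have -> : beta%:E = ((beta / 2)%:E + (beta / 2)%:E)%E by rewrite -EFinD; congr EFin; lra.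
apply: le_trans (leeD stat_tail N_tail); apply: le_trans (measureU2 _ mstat mN).
apply: le_measure; rewrite ?inE; [exact: mtest|exact: measurableU|].
move=> w /= tw; have [KN|NK] := ltP (K * L) (N w)%:R; [by right|left].
apply: (test_eq0_stat_le L0 NXP sz a01 JL _ tw (leqnn _)) => n nN.
by apply: tail => //; apply: le_trans NK; rewrite ler_nat.
Qed.

Theorem proposition1 (R : realType) (delta : R) (delta_gt0 : 0 < delta) :
  (forall alpha beta M : R, 0 < alpha < 1 -> 0 < beta < 1 -> 0 < M ->
   exists C : R, 0 < C /\
   forall (L r : R), 1 <= ln (ln L) -> 0 < r ->
   forall (d : measure_display) (Omega : measurableType d)
     (N : Omega -> nat) (X : nat -> Omega -> R)
     (P : (R -> R) -> probability Omega R),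
   poisson_experiment N X L P ->
   forall s : R -> R, besov_ball delta r s -> sup_ball M s ->
   l2dist s constant_functions ^+ 2 >
     C * (r `^ (2 / (4 * delta + 1)) *
            (Num.sqrt (ln (ln L)) / L) `^ (4 * delta / (4 * delta + 1))
          + r ^+ 2 * (ln (ln L) ^+ 3 / L ^+ 2) `^ (2 * delta)
          + ln (ln L) / L) ->
   (P s [set w | test1 N X L P alpha w = 0%N] <= beta%:E)%E)
  /\
  (exists L0 : R, 0 < L0 /\
   forall alpha beta r M : R, 0 < alpha < 1 -> 0 < beta < 1 -> 0 < r -> 0 < M ->
   exists C : R, 0 < C /\
   forall L : R, 1 <= ln (ln L) -> L0 < L ->
   forall (d : measure_display) (Omega : measurableType d)
     (N : Omega -> nat) (X : nat -> Omega -> R)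
     (P : (R -> R) -> probability Omega R),
   poisson_experiment N X L P ->
   (separation_rate P (test1 N X L P alpha)
      (besov_ball delta r `&` sup_ball M) beta
    <= (C * (Num.sqrt (ln (ln L)) / L) `^ (2 * delta / (4 * delta + 1)))%:E)%E).
Proof.
have part1 (alpha beta M : R) : 0 < alpha < 1 -> 0 < beta < 1 -> 0 < M ->
   exists C : R, 0 < C /\
   forall (L r : R), 1 <= ln (ln L) -> 0 < r ->
   forall (d : measure_display) (Omega : measurableType d)
     (N : Omega -> nat) (X : nat -> Omega -> R)
     (P : (R -> R) -> probability Omega R),
   poisson_experiment N X L P ->
   forall s : R -> R, besov_ball delta r s -> sup_ball M s ->
   l2dist s constant_functions ^+ 2 >
     C * (r `^ (2 / (4 * delta + 1)) *
            (Num.sqrt (ln (ln L)) / L) `^ (4 * delta / (4 * delta + 1))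
          + r ^+ 2 * (ln (ln L) ^+ 3 / L ^+ 2) `^ (2 * delta)
          + ln (ln L) / L) ->
   (P s [set w | test1 N X L P alpha w = 0%N] <= beta%:E)%E.
  move=> a01 b01 M0; have [C1 [L1 [C10 L10 power]]] := test1_power a01 b01 M0.
  pose B : R := (1 - 2 `^ (- (2 * delta)))^-1.
  have B0 : 0 < B.
    rewrite invr_gt0 subr_gt0 powRN invf_lt1 ?powR_gt0 //.
    apply: (@le_lt_trans _ _ (1 `^ (2 * delta))); first by rewrite powR1.
    by apply: gt0_ltr_powR; rewrite ?nnegrE //; lra.
  pose q : R := 2 `^ (2 * delta).
  have q0 : 0 < q by exact: powR_gt0.
  have Bq0 : 0 < B * q by rewrite mulr_gt0.
  have ML0 : 0 <= M ^+ 2 * L1 by rewrite mulr_ge0 ?sqr_ge0 // ltW.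
  (* [3 * C1] pays for the deviation, [B] and [B * q] for the two parts of the bias, and
     [M ^+ 2 * L1] for the small values of [L]. *)
  exists (3 * C1 + B + B * q + M ^+ 2 * L1); split; first by lra.
  move=> L r t1 r0 d Omega N X P NXP s sB sM.
  have [L_gt1 _ _ _ _] := lnln_ge1 t1.
  have is_s : intensities s by case: sB.
  have [[ms _] s_ge0] := is_s.
  have s01 (x : R) : 0 <= x <= 1 -> 0 <= s x <= M.
    by move=> x01; rewrite s_ge0 //= (le_trans (ler_norm _)) // sM.
  rewrite -[r `^ _ * _]/(balanced_rate delta r (Num.sqrt (ln (ln L)) / L)).
  set e := balanced_rate _ _ _; set b := r ^+ 2 * _; set tL := ln (ln L) / L => dist.
  have e0 : 0 <= e by apply: mulr_ge0; exact: powR_ge0.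
  have b0 : 0 <= b by apply: mulr_ge0; [exact: sqr_ge0|exact: powR_ge0].
  have tL0 : 0 < tL by rewrite divr_gt0; lra.
  (* If [L < L1], the last term of the hypothesis is already at least [M ^ 2], which bounds the
     squared distance. *)
  have LL1 : L1 <= L.
    rewrite leNgt; apply/negP => LL1.
    have dM := l2dist_le_bound ms s01.
    have : M ^+ 2 <= (M ^+ 2 * L1) * tL.
      rewrite -mulrA ler_peMr ?sqr_ge0 // mulrA ler_pdivlMr; last by lra.
      by rewrite mul1r (le_trans (ltW LL1)) // ler_peMr // ltW.
    have : 0 <= (3 * C1 + B + B * q + M ^+ 2 * L1) * (e + b) by apply: mulr_ge0; lra.
    have : 0 <= (3 * C1 + B + B * q) * tL by apply: mulr_ge0; lra.
    move: dist dM; rewrite !mulrDl !mulrDr; lra.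
  have [sz {}power] := power L LL1 t1.
  have [J JL [dev bias]] := level_choice delta_gt0 r0 t1 sz.
  apply: (power _ _ _ _ _ NXP s J is_s s01 JL); clear sz JL.
  have := besov_dist ms s01 J delta_gt0 sB; rewrite -/B.
  have -> : r ^+ 2 * B * (2 ^+ J) `^ (- (2 * delta)) = B * (r ^+ 2 * (2 ^+ J) `^ (- (2 * delta))).
    by ring.
  have biasB := ler_wpM2l (ltW B0) bias.
  have devC := ler_wpM2l (ltW C10) dev.
  have -> : C1 * (Num.sqrt (2 ^+ J * ln (ln L)) + ln (ln L)) / L =
     C1 * (Num.sqrt (2 ^+ J * ln (ln L)) / L) + C1 * tL by rewrite /tL; ring.
  rewrite -/e -/b -/q -/tL in biasB devC.
  move: biasB devC dist; set u := _ `^ _; set v := Num.sqrt _ / L.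
  move: (l2dist _ _ ^+ 2) (energy s J) => dd th.
  have p1 : 0 <= C1 * e by apply: mulr_ge0; lra.
  have p2 : 0 <= C1 * b by apply: mulr_ge0; lra.
  have p3 : 0 <= B * tL by apply: mulr_ge0; lra.
  have p4 : 0 <= B * b by apply: mulr_ge0; lra.
  have p5 : 0 <= B * q * e by apply: mulr_ge0; lra.
  have p6 : 0 <= B * q * tL by apply: mulr_ge0; lra.
  have p7 : 0 <= (M ^+ 2 * L1) * (e + b + tL) by apply: mulr_ge0; lra.
  lra.
split; first exact: part1.
(* [rate_terms_le] holds as soon as [1 <= ln (ln L)], so [L0 = 1] will do. *)
exists 1; split => // alpha beta r M a01 b01 r0 M0.
have [C [C0 power]] := part1 alpha beta M a01 b01 M0.
have [K K0 rate] := rate_terms_le delta_gt0 r0.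
exists (Num.sqrt (C * K)); split; first by rewrite sqrtr_gt0 mulr_gt0.
move=> L t1 _ d Omega N X P NXP; have [L_gt1 _ _ _ _] := lnln_ge1 t1.
set y := Num.sqrt (ln (ln L)) / L in rate *.
have y0 : 0 < y by rewrite divr_gt0 ?sqrtr_gt0; lra.
(* The claimed rate is itself an admissible radius; its square is [C * K] times the main term of the
   first part. *)
apply: ereal_inf_lbound; exists (Num.sqrt (C * K) * y `^ (2 * delta / (4 * delta + 1))) => //.
split; first by rewrite mulr_gt0 ?powR_gt0 // sqrtr_gt0 mulr_gt0.
apply: ge_ereal_sup => _ [s [[sB sM] sd] <-].
apply: (power L r t1 r0 d Omega N X P NXP s sB sM).
apply: (@le_lt_trans _ _ (C * (K * y `^ (4 * delta / (4 * delta + 1))))).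
  by rewrite ler_pM2l //; exact: rate.
have -> : C * (K * y `^ (4 * delta / (4 * delta + 1))) =
   (Num.sqrt (C * K) * y `^ (2 * delta / (4 * delta + 1))) ^+ 2.
  rewrite exprMn sqr_sqrtr; last by rewrite mulr_ge0 // ltW.
  rewrite -powR_mulrn ?powR_ge0 // -powRrM mulrA; congr (_ * _ `^ _); field.
  by apply: lt0r_neq0; lra.
have pos : 0 <= Num.sqrt (C * K) * y `^ (2 * delta / (4 * delta + 1)).
  by apply: mulr_ge0; [exact: sqrtr_ge0|exact: powR_ge0].
by rewrite ltr_sqr ?nnegrE // (le_trans pos) // ltW.
Qed.
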